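(* Let $G$ be a finitely generated generalized Baumslag--Solitar group with modular homomorphism $q \colon G \to \mathbb{Q}^{\times}_{>0}$. If $q(G) \cap \mathbb{Z} = \{1\}$, then there are only finitely many reduced graphs of groups $(A,i)_{\mathbb{Z}}$ with fundamental group isomorphic to $G$.
   Context: A $G$-tree is a simplicial tree with an action of $G$ by automorphisms, without inversions. A generalized Baumslag--Solitar tree is a $G$-tree all of whose vertex and edge stabilizers are infinite cyclic; the groups $G$ that arise are the generalized Baumslag--Solitar groups. Equivalently, they are the fundamental groups of graphs of infinite cyclic groups. Graphs are in the sense of Serre: a graph $A$ has vertices $V(A)$, oriented edges $E(A)$, maps $\partial_0,\partial_1 \colon E(A)\to V(A)$ and a fixed-point-free involution $e\mapsto\overline{e}$ with $\partial_0\overline{e}=\partial_1 e$. Given a connected graph $A$ and a function $i\colon E(A)\to\mathbb{Z}-\{0\}$, $(A,i)_{\mathbb{Z}}$ is the graph of groups with underlying graph $A$, all vertex and edge groups infinite cyclic, and the inclusion of the group of the edge $e$ into the group of $\partial_0 e$ given by multiplication by $i(e)$. Such graphs of groups are counted up to isomorphism. (Changing the signs of all indices at one vertex, or changing the signs of $i(e)$ and $i(\overline{e})$ together, does not change the graph of groups.) $(A,i)_{\mathbb{Z}}$ is reduced if every edge $e$ with $i(e)=\pm1$ is a loop, i.e. $\partial_0 e=\partial_1 e$. The modular homomorphism $q \colon G \to \mathbb{Q}^{\times}_{>0}$ (positive rationals under multiplication) of a generalized Baumslag--Solitar tree with group $G$ is $$q(g) = [V : V \cap V^g] \,/\, [V^g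 : V\cap V^g],$$ where $V^g=gVg^{-1}$ and $V$ is any subgroup of $G$ commensurable with a vertex stabilizer (the value does not depend on the choice of $V$). Here $q$ is taken with respect to a generalized Baumslag--Solitar tree with group $G$; it does not depend on which one. *)

(* Defs.v *)
From HB Require Import structures.
From mathcomp Require Import all_boot all_order all_algebra.
From mathcomp Require Import boolp classical_sets cardinality.
From mathcomp Require Import finmap.

Set Implicit Arguments.
Unset Strict Implicit.
Unset Printing Implicit Defensive.

Local Open Scope classical_set_scope.

(** * Groups *)

Section Groups.
Variable G : groupType.
Local Open Scope group_scope.
Implicit Types (H K : set G) (g x : G).

Definition is_subgroup H : Prop := group_closed (mem H).

Definition finitely_generated : Prop :=
  exists s : seq G, forall H, is_subgroup H -> [set` s] `<=` H -> H = setT.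

Definition expgz x (n : int) : G :=
  match n with Posz k => x ^+ k | Negz k => x ^- k.+1 end.

Definition infinite_cyclic H : Prop :=
  exists2 x, H = range (expgz x) & injective (expgz x).

Definition lcosets_in H K : set (set G) := [set [set h * k | k in K] | h in H].

(* As [fset_set] sends infinite sets to [fset0], this is 0 when [H : K] is
   infinite. *)
Definition subg_index H K : nat := #|` fset_set (lcosets_in H K)|.

Definition commensurable H K : Prop :=
  finite_set (lcosets_in H (H `&` K)) /\ finite_set (lcosets_in K (H `&` K)).

(* This is [g H g^-1]; the library's [x ^ g] is [g^-1 x g]. *)
Definition conj_by g H : set G := [set g * h * g^-1 | h in H].

Definition modulus H g : rat :=
  ((subg_index H (H `&` conj_by g H))%:R
     / (subg_index (conj_by g H) (H `&` conj_by g H))%:R)%R.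

End Groups.

Arguments finitely_generated : clear implicits.

Definition isomorphic (G H : groupType) : Prop :=
  exists f : {multiplicative G -> H}, bijective f.

(** * Groups given by generators and relations *)

(* The letter (x, true) is x and the letter (x, false) is its inverse. *)
Definition word (X : Type) : Type := {classic seq (X * bool)}.

Section Presentation.
Variables (X : Type) (R : word X -> word X -> Prop).

Inductive word_eq : word X -> word X -> Prop :=
| word_refl u : word_eq u u
| word_sym u v : word_eq u v -> word_eq v u
| word_trans u v w : word_eq u v -> word_eq v w -> word_eq u w
| word_cat u u' v v' : word_eq u u' -> word_eq v v' -> word_eq (u ++ v) (u' ++ v')
| word_cancel x b : word_eq [:: (x, b); (x, ~~ b)] [::]
| word_rel u v : R u v -> word_eq u v.

Definition word_eqb (u v : word X) : bool := `[< word_eq u v >].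

Lemma word_eqb_refl : reflexive word_eqb.
Proof. by move=> u; apply/asboolP; apply: word_refl. Qed.

Lemma word_eqb_sym : symmetric word_eqb.
Proof.
by move=> u v; apply/idP/idP => /asboolP uv; apply/asboolP; apply: word_sym.
Qed.

Lemma word_eqb_trans : transitive word_eqb.
Proof.
move=> v u w /asboolP uv /asboolP vw; apply/asboolP.
exact: word_trans uv vw.
Qed.

Canonical word_equiv := EquivRel word_eqb word_eqb_refl word_eqb_sym word_eqb_trans.

Definition presented : Type := {eq_quot word_equiv}%qT.
HB.instance Definition _ := Choice.on presented.
HB.instance Definition _ := EqQuotient.on presented.

Local Open Scope quotient_scope.

Definition inv_word (u : word X) : word X := rev [seq (a.1, ~~ a.2) | a <- u].

Definition presented_class (u : word X) : presented := \pi_presented u.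

Definition presented_one : presented := presented_class [::].
Definition presented_mul (a b : presented) : presented :=
  presented_class (repr a ++ repr b).
Definition presented_inv (a : presented) : presented :=
  presented_class (inv_word (repr a)).

Lemma presented_classE u v :
  presented_class u = presented_class v <-> word_eq u v.
Proof.
split; first by move/eqmodP/asboolP.
by move=> uv; apply/eqmodP/asboolP.
Qed.

Lemma repr_class u : word_eq (repr (presented_class u)) u.
Proof. by apply/presented_classE; rewrite /presented_class reprK. Qed.

Lemma presented_repr (a : presented) : presented_class (repr a) = a.
Proof. by rewrite /presented_class reprK. Qed.

Lemma presented_mulE u v :
  presented_mul (presented_class u) (presented_class v) = presented_class (u ++ v).
Proof. by apply/presented_classE; apply: word_cat; apply: repr_class. Qed.

Lemma word_invr (u : word X) : word_eq (u ++ inv_word u) [::].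
Proof.
elim: u => [|[x b] u IH]; first exact: word_refl.
have -> : ((x, b) :: u) ++ inv_word ((x, b) :: u)
  = [:: (x, b)] ++ ((u ++ inv_word u) ++ [:: (x, ~~ b)]) :> seq _.
  by rewrite /inv_word /= rev_cons -cats1 catA.
apply: word_trans (word_cancel x b).
by apply: (word_cat (word_refl [:: _])); apply: (word_cat IH (word_refl [:: _])).
Qed.

Lemma inv_wordK (u : word X) : inv_word (inv_word u) = u.
Proof.
rewrite /inv_word map_rev revK -map_comp -[RHS]map_id.
by apply: eq_map => -[x b] /=; rewrite negbK.
Qed.

Lemma presented_mulA : associative presented_mul.
Proof.
move=> a b c; rewrite -(presented_repr a) -(presented_repr b) -(presented_repr c).
by rewrite !presented_mulE catA.
Qed.

Lemma presented_mul1 : left_id presented_one presented_mul.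
Proof. by move=> a; rewrite -(presented_repr a) presented_mulE. Qed.

Lemma presented_mulr1 : right_id presented_one presented_mul.
Proof. by move=> a; rewrite -(presented_repr a) presented_mulE cats0. Qed.

Lemma presented_mulV : left_inverse presented_one presented_inv presented_mul.
Proof.
move=> a; rewrite -{2}(presented_repr a) presented_mulE.
apply/presented_classE; rewrite -{2}(inv_wordK (repr a)).
exact: word_invr.
Qed.

Lemma presented_mulrV : right_inverse presented_one presented_inv presented_mul.
Proof.
move=> a; rewrite -{1}(presented_repr a) presented_mulE.
exact/presented_classE/word_invr.
Qed.

HB.instance Definition _ := isGroup.Build presented presented_mulA
  presented_mul1 presented_mulr1 presented_mulV presented_mulrV.

End Presentation.

(** * Graphs and trees in the sense of Serre *)

Record graph := Graph {
  vertex : Type;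
  edge : Type;
  d0 : edge -> vertex;
  d1 : edge -> vertex;
  bar : edge -> edge;
  barK : involutive bar;
  bar_neq : forall e, bar e <> e;
  d0_bar : forall e, d0 (bar e) = d1 e }.

Section Trees.
Variable A : graph.
Implicit Types (S : set (edge A)) (v w : vertex A) (e : edge A) (p : seq (edge A)).

Fixpoint edge_path S v w p : Prop :=
  if p is e :: p' then [/\ S e, d0 e = v & edge_path S (d1 e) w p'] else v = w.

Definition reduced_path p : Prop :=
  forall p1 e p2, p <> p1 ++ [:: e, bar e & p2].

Definition connected_by S : Prop :=
  inhabited (vertex A) /\ forall v w, exists p, edge_path S v w p.

Definition spanning_tree S : Prop :=
  [/\ forall e, S e -> S (bar e),
      connected_by S &
      forall v p, edge_path S v v p -> reduced_path p -> p = [::]].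

Definition connected : Prop := connected_by setT.
Definition is_tree : Prop := spanning_tree setT.

End Trees.

(** * Generalized Baumslag-Solitar trees *)

Record Gtree (G : groupType) := GTree {
  gt_graph :> graph;
  gt_tree : is_tree gt_graph;
  actV : G -> vertex gt_graph -> vertex gt_graph;
  actE : G -> edge gt_graph -> edge gt_graph;
  actV1 : forall v, actV 1%g v = v;
  actVM : forall g h v, actV (g * h)%g v = actV g (actV h v);
  actE1 : forall e, actE 1%g e = e;
  actEM : forall g h e, actE (g * h)%g e = actE g (actE h e);
  act_d0 : forall g e, d0 (actE g e) = actV g (d0 e);
  act_bar : forall g e, bar (actE g e) = actE g (bar e);
  no_inversion : forall g e, actE g e <> bar e }.

Section GBSTrees.
Variables (G : groupType) (X : Gtree G).

Definition stabV (v : vertex X) : set G := [set g | actV g v = v].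
Definition stabE (e : edge X) : set G := [set g | actE g e = e].

Definition GBS_tree : Prop :=
  (forall v, infinite_cyclic (stabV v)) /\ (forall e, infinite_cyclic (stabE e)).

Definition modular_homomorphism (q : G -> rat) : Prop :=
  exists V : set G, [/\ is_subgroup V,
    exists v, commensurable V (stabV v) & forall g, q g = modulus V g].

End GBSTrees.

(** * Graphs of infinite cyclic groups *)

(* The pair (A, i) stands for the graph of groups with every vertex and edge
   group equal to [int] and the group of [e] (which is also that of [bar e])
   mapped to the group of [d0 e] by multiplication by [gi e]. *)
Record Zgraph := ZGraph {
  zg_graph :> graph;
  zg_connected : connected zg_graph;
  gi : edge zg_graph -> int;
  gi_neq0 : forall e, gi e <> 0%R }.

Definition reduced (A : Zgraph) : Prop :=
  forall e : edge A, `|gi e|%N = 1%N -> d0 e = d1 e.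

(* The vertex groups being abelian, the squares formed by the edge inclusions,
   which in general commute up to conjugation, commute strictly. *)
Definition Zgraph_iso (A B : Zgraph) : Prop :=
  exists (fV : vertex A -> vertex B) (fE : edge A -> edge B)
         (aV : vertex A -> {additive int -> int})
         (aE : edge A -> {additive int -> int}),
  [/\ bijective fV /\ bijective fE,
      forall e, d0 (fE e) = fV (d0 e) /\ bar (fE e) = fE (bar e),
      (forall v, bijective (aV v)) /\ (forall e, bijective (aE e)),
      forall e, aE (bar e) =1 aE e &
      forall e n, aV (d0 e) (gi e * n)%R = (gi (fE e) * aE e n)%R].

Section FundamentalGroup.
Variables (A : Zgraph) (S : set (edge A)).

(* [inl v] is a generator of the group of [v]; [inr e] is the stable letter
   of [e]. *)
Definition pi1_gen : Type := (vertex A + edge A)%type.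

Definition wpow (x : pi1_gen) (n : int) : word pi1_gen :=
  match n with Posz k => nseq k (x, true) | Negz k => nseq k.+1 (x, false) end.

Inductive pi1_rel : word pi1_gen -> word pi1_gen -> Prop :=
| pi1_rel_bar e : pi1_rel (wpow (inr (bar e)) 1%R) (wpow (inr e) (-1)%R)
| pi1_rel_edge e :
    pi1_rel (wpow (inr e) 1%R ++ wpow (inl (d1 e)) (gi (bar e)) ++ wpow (inr e) (-1)%R)
            (wpow (inl (d0 e)) (gi e))
| pi1_rel_tree e : S e -> pi1_rel (wpow (inr e) 1%R) [::].

Definition pi1 : groupType := presented pi1_rel.

End FundamentalGroup.

(* Up to isomorphism [pi1 S] does not depend on the maximal tree [S]. *)
Definition has_fundamental_group (A : Zgraph) (G : groupType) : Prop :=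
  exists2 S : set (edge A), spanning_tree S & isomorphic (pi1 S) G.

(* Main.v *)
Require Import Defs.
From HB Require Import structures.
From mathcomp Require Import all_boot all_order all_algebra.
From mathcomp Require Import boolp classical_sets cardinality.
From mathcomp Require Import finmap zify.

Set Implicit Arguments.
Unset Strict Implicit.
Unset Printing Implicit Defensive.

Import Order.TTheory GRing.Theory Num.Theory.
Local Open Scope classical_set_scope.

(** Fix a generator [c] of a vertex stabilizer of [X]. It has infinite order and
    is commensurated: every [g] satisfies [g c^m g^-1 = c^n] for some nonzero
    [m] and [n], and then [q g] is [n / m] up to sign. So the hypothesis on [q]
    says that [m] divides [n] only if [|m| = |n|] ([no_integral_modulusP]).

    A reduced graph of groups [A] with fundamental group [G] is studied through
    its Bass-Serre tree [T], built on cosets in [G] ([bass_serre_tree]); that it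
    is a tree is the normal form theorem ([reduced_word_neq1]), proved by letting
    the group act on normal forms. Since [A] is reduced, [T] is minimal, so that
    every edge of [T] is crossed, up to translation, by a path from a given
    vertex [p] to [g p], with [g] one of the generators ([generator_separated]).

    If [c] fixes no vertex of [T], then, being commensurated, it has an axis that
    [G] preserves. By minimality [T] is this axis, so [A] has at most two
    vertices and its indices are at most two in absolute value ([line_bounds]).

    Suppose that [c] fixes a vertex [p] of [T]. All vertex stabilizers are then
    commensurable with the subgroup generated by [c]. Without nontrivial integral
    moduli they are exactly the maximal elliptic subgroups, and each determines
    its vertex up to the action of [G] ([stabV_maximal]). Elliptic elements being
    those with a power in common with [c], these subgroups are the same for all
    such [A]; so the vertices of [A] inject into those of any fixed such
    decomposition [A0], which is finite by minimality.

    For the indices, an edge crossed by the path from [p] to [g p] is fixed by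
    [c^n], where [g c^m g^-1 = c^n], a power that depends on [G] only. Since
    there are finitely many conjugacy classes of vertex groups, the index of the
    edge divides some [k] such that [c^k] is conjugate to one of finitely many
    powers [c^N] ([index_conj_power]). For fixed [N], if [c^k] and [c^k'] are
    conjugate to [c^N] and [k] divides [k'], then [|k| = |k'|]: the possible [k]
    form an antichain for divisibility. Only finitely many primes occur in them,
    because [G] is finitely generated, so by Dickson's lemma they are bounded
    ([conj_power_bounded]).

    Finally the edges outside a maximal tree are told apart by homomorphisms from
    [G] to a group of order three ([edge_injection]), and graphs with bounded
    numbers of vertices and edges and bounded indices are finitely many up to
    isomorphism ([coded_finite]). *)

(** * Integral powers and commensuration of a cyclic subgroup *)

Section IntegralPowers.
Variable G : groupType.
Implicit Types (x y g : G) (m n : int).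

Local Open Scope group_scope.
Local Notation "x ^z n" := (expgz x n) (at level 29, left associativity).

Lemma expgz0 x : x ^z 0 = 1. Proof. by []. Qed.

Lemma expgz1 x : x ^z 1 = x. Proof. by []. Qed.

Lemma expgzS x n : x ^z (n + 1)%R = x ^z n * x.
Proof.
case: n => [n|[|n]] /=; first by rewrite addn1 expgSr.
  by rewrite expg1 mulVg.
by rewrite subn1 /= (expgS _ n.+1) invgM mulgVK.
Qed.

Lemma expgzB1 x n : x ^z (n - 1)%R = x ^z n * x^-1.
Proof. by rewrite -{2}(subrK 1%R n) expgzS mulgK. Qed.

Lemma expgzD x m n : x ^z (m + n)%R = x ^z m * x ^z n.
Proof.
elim/int_rect: n => [|n IH|n IH]; first by rewrite addr0 mulg1.
  by rewrite -addn1 PoszD addrA !expgzS IH mulgA.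
by rewrite -addn1 PoszD opprD addrA !expgzB1 IH mulgA.
Qed.

Lemma expgzN x n : x ^z (- n)%R = (x ^z n)^-1.
Proof. by apply: (mulIg (x ^z n)); rewrite -expgzD addNr mulVg. Qed.

Lemma expgzM x m n : x ^z (m * n)%R = x ^z m ^z n.
Proof.
elim/int_rect: n => [|n IH|n IH]; first by rewrite mulr0.
  by rewrite -addn1 PoszD mulrDr mulr1 expgzS expgzD IH.
by rewrite -addn1 PoszD opprD expgzB1 -IH mulrDr mulrN1 expgzD expgzN.
Qed.

Lemma expgzC x m n : x ^z m ^z n = x ^z n ^z m.
Proof. by rewrite -!expgzM mulrC. Qed.

Lemma expgzJ g x n : g * x ^z n * g^-1 = (g * x * g^-1) ^z n.
Proof.
elim/int_rect: n => [|n IH|n IH]; first by rewrite !expgz0 mulg1 mulgV.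
  by rewrite -addn1 PoszD !expgzS -IH !mulgA mulgVK.
by rewrite -addn1 PoszD opprD !expgzB1 -IH !invgM invgK !mulgA mulgVK.
Qed.

Lemma expg1z n : 1 ^z n = 1 :> G.
Proof. by case: n => n /=; rewrite expg1n // invg1. Qed.

Definition infinite_order x := injective (expgz x).

Lemma infinite_order_neq0 x n : infinite_order x -> x ^z n = 1 -> n = 0%R.
Proof. by move=> xi xn; apply: xi. Qed.

Lemma infinite_orderP x : (forall n, x ^z n = 1 -> n = 0%R) -> infinite_order x.
Proof.
move=> H m n mn; apply/eqP; rewrite -subr_eq0; apply/eqP/H.
by rewrite expgzD expgzN mn mulgV.
Qed.

Lemma infinite_orderX x n : n <> 0%R -> infinite_order x -> infinite_order (x ^z n).
Proof.
move=> n0 xi; apply: infinite_orderP => m; rewrite -expgzM.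
move/(infinite_order_neq0 xi)/eqP; rewrite mulf_eq0 => /orP[/eqP //|/eqP //].
Qed.

Lemma infinite_orderJ x g : infinite_order x -> infinite_order (g * x * g^-1).
Proof.
move=> xi; apply: infinite_orderP => m; rewrite -expgzJ => /eqP.
rewrite divg_eq1 => /eqP gx; apply: (infinite_order_neq0 xi).
by apply: (mulgI g); rewrite gx mulg1.
Qed.

(** Commensurability of the subgroups generated by two elements of infinite
    order. *)
Definition commens x y := exists m n, [/\ m <> 0%R, n <> 0%R & x ^z m = y ^z n].

Lemma commens_sym x y : commens x y -> commens y x.
Proof. by case=> m [n [m0 n0 e]]; exists n, m. Qed.

Lemma mulz_neq0 m n : m <> 0%R -> n <> 0%R -> (m * n)%R <> 0%R.
Proof. by move=> m0 n0 /eqP; rewrite mulf_eq0 => /orP[] /eqP. Qed.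

Lemma commens_trans x y z : commens x y -> commens y z -> commens x z.
Proof.
case=> m [n [m0 n0 e]] [m' [n' [m0' n0' e']]].
exists (m * m')%R, (n' * n)%R; split; try exact: mulz_neq0.
by rewrite !expgzM e expgzC e'.
Qed.

Lemma commensX x m : m <> 0%R -> commens (x ^z m) x.
Proof. by move=> m0; exists 1%R, m. Qed.

(** When [x] has infinite order and generates a commensurated subgroup, this says
    that the modulus of [g] is [n / m] up to sign, without mention of indices. *)
Definition conj_power x g m n :=
  [/\ m <> 0%R, n <> 0%R & g * x ^z m * g^-1 = x ^z n].

Lemma conj_powerV x g m n : conj_power x g m n -> conj_power x g^-1 n m.
Proof. by case=> m0 n0 e; split=> //; rewrite -e invgK !mulgA mulVg mul1g mulgVK. Qed.

Lemma conj_power_ratio x g m n m' n' : infinite_order x ->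
  conj_power x g m n -> conj_power x g m' n' -> (n * m' = n' * m)%R.
Proof.
move=> xi [_ _ e] [_ _ e']; apply: xi.
by rewrite !expgzM -e -e' -!expgzJ expgzC.
Qed.

End IntegralPowers.

Notation "x ^z n" := (expgz x n) (at level 29, left associativity) : group_scope.

(** * Indices and the modular homomorphism *)

Section Index.
Variable G : groupType.
Implicit Types (H K L : set G) (x y g : G) (m n : int).
Local Open Scope group_scope.

Record subgroup H : Prop := Subgroup {
  subgroup1 : H 1;
  subgroupM : forall x y, H x -> H y -> H (x * y);
  subgroupV : forall x, H x -> H x^-1 }.

Lemma is_subgroupP H : is_subgroup H <-> subgroup H.
Proof.
split=> [[/set_mem H1 HD]|[H1 HM HV]].
  have HV x : H x -> H x^-1.
    by move=> Hx; rewrite -[x^-1]mul1g; apply/set_mem/HD; apply/mem_set.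
  split=> // x y Hx Hy; rewrite -[y]invgK.
  by apply/set_mem/HD; apply/mem_set => //; apply: HV.
split=> [|x y /set_mem Hx /set_mem Hy]; apply/mem_set => //.
by apply: HM => //; apply: HV.
Qed.

Definition cyclic_set x : set G := range (expgz x).

Lemma cyclic_subgroup x : subgroup (cyclic_set x).
Proof.
split=> [|_ _ [m _ <-] [n _ <-]|_ [m _ <-]]; first by exists 0%R.
  by exists (m + n)%R; rewrite ?expgzD.
by exists (- m)%R; rewrite ?expgzN.
Qed.

Lemma conj_by_subgroup g H : subgroup H -> subgroup (conj_by g H).
Proof.
case=> H1 HM HV; split=> [|_ _ [x Hx <-] [y Hy <-]|_ [x Hx <-]].
- by exists 1; rewrite ?mulg1 ?mulgV.
- by exists (x * y); [exact: HM | rewrite !mulgA mulgVK].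
- by exists x^-1; [exact: HV | rewrite !invgM invgK mulgA].
Qed.

Lemma subgroupI H K : subgroup H -> subgroup K -> subgroup (H `&` K).
Proof.
move=> [H1 HM HV] [K1 KM KV].
by split=> [|x y [? ?] [? ?]|x [? ?]]; split; auto.
Qed.

Lemma conj_by_cyclic g x : conj_by g (cyclic_set x) = cyclic_set (g * x * g^-1).
Proof.
apply/seteqP; split=> [_ [_ [n _ <-] <-]|_ [n _ <-]].
  by exists n; rewrite ?expgzJ.
by exists (x ^z n); [exists n | rewrite expgzJ].
Qed.

(** A left transversal of [K] in [H], indexed by a finite type: a form of the
    index that multiplies along towers by taking products of index types. *)
Definition transversal H K (T : finType) (f : T -> G) : Prop :=
  [/\ forall t, H (f t), forall t u, K ((f t)^-1 * f u) -> t = u &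
      forall h, H h -> exists t, K ((f t)^-1 * h)].

Definition has_index H K (d : nat) : Prop :=
  exists (T : finType) (f : T -> G), transversal H K f /\ #|T| = d.

Lemma lcoset_eq K x y : subgroup K ->
  [set x * k | k in K] = [set y * k | k in K] <-> K (x^-1 * y).
Proof.
move=> sK; split=> [xy|Kxy].
  have : [set y * k | k in K] y by exists 1; rewrite ?mulg1 //; apply: subgroup1.
  by rewrite -xy => -[k Kk <-]; rewrite mulKg.
apply/seteqP; split=> _ [k Kk <-].
  exists (y^-1 * x * k); last by rewrite !mulgA mulgV mul1g.
  by apply: subgroupM => //; rewrite -[y^-1 * x]invgK invgM invgK; apply: subgroupV.
exists (x^-1 * y * k); last by rewrite !mulgA mulgV mul1g.
exact: subgroupM.
Qed.

Lemma has_index_subg H K d : subgroup K -> has_index H K d -> subg_index H K = d.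
Proof.
move=> sK [T [f [[Hf inj_f surj_f] <-]]].
rewrite /subg_index; apply: card_fset_set.
have -> : lcosets_in H K =
    [set [set f (enum_val i) * k | k in K] | i in [set: 'I_#|T|]].
  apply/seteqP; split=> [_ [h Hh <-]|_ [i _ <-]]; last by exists (f (enum_val i)).
  have [t Kt] := surj_f h Hh; exists (enum_rank t) => //.
  by rewrite enum_rankK; apply/(lcoset_eq _ _ sK).
apply: card_eq_trans (card_esym card_II).
apply: inj_card_eq => i j _ _ /(lcoset_eq _ _ sK)/inj_f/enum_val_inj//.
Qed.

Lemma has_index_finite H K : subgroup K -> finite_set (lcosets_in H K) ->
  exists d, has_index H K d.
Proof.
move=> sK /finite_fsetP[X HX].
have rep (C : X) : exists h, H h /\ [set h * k | k in K] = val C.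
  have : lcosets_in H K (val C) by rewrite HX /=; apply: valP.
  by case=> h Hh hC; exists h.
have [f Hf] := choice rep.
exists #|{: X}|, X, f; split=> //; split=> [t|t u|h Hh]; first by case: (Hf t).
  by move/(lcoset_eq _ _ sK); rewrite (Hf t).2 (Hf u).2 => /val_inj.
have hX : [set h * k | k in K] \in X.
  by have : lcosets_in H K [set h * k | k in K] by [exists h]; rewrite HX.
by exists [` hX]%fset; apply/(lcoset_eq _ _ sK); rewrite (Hf _).2.
Qed.

Lemma finite_has_index H K d : subgroup K -> has_index H K d ->
  finite_set (lcosets_in H K).
Proof.
move=> sK [T [f [[Hf inj_f surj_f] _]]].
apply: sub_finite_set
  (finite_image (fun t => [set f t * k | k in K]) (@finite_finset T setT)).
move=> _ [h Hh <-]; have [t Kt] := surj_f h Hh; exists t => //.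
exact/(lcoset_eq _ _ sK).
Qed.

Lemma has_indexM H K L d d' : subgroup H -> subgroup K -> K `<=` H -> L `<=` K ->
  has_index H K d -> has_index K L d' -> has_index H L (d * d')%N.
Proof.
move=> sH sK KH LK [T [f [[Hf inj_f surj_f] <-]]] [U [f' [[Kf inj_f' surj_f'] <-]]].
exists (T * U)%type, (fun p => f p.1 * f' p.2); split; last by rewrite card_prod.
split=> [[t u]|[t u] [t' u'] /=|h Hh] /=.
- by apply: subgroupM => //; apply/KH/Kf.
- rewrite invgM !mulgA => Le.
  have tt' : t = t'.
    apply: inj_f; have := LK _ Le => Ke.
    have := subgroupM sK (subgroupM sK (Kf u) Ke) (subgroupV sK (Kf u')).
    by rewrite !mulgA mulgV mul1g mulgK.
  by move: Le; rewrite -tt' mulgVK => /inj_f' ->.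
have [t Kt] := surj_f h Hh; have [u Lu] := surj_f' _ Kt.
by exists (t, u); rewrite invgM -mulgA.
Qed.

Lemma has_index_cyclic x n : infinite_order x -> n <> 0%R ->
  has_index (cyclic_set x) (cyclic_set (x ^z n)) `|n|%N.
Proof.
move=> xi n0; exists 'I_`|n|%N, (fun i : 'I_`|n|%N => x ^z (Posz i)).
split; last by rewrite card_ord.
have n1 : (0 < `|n|)%N by rewrite absz_gt0; apply/eqP.
split=> [i|i j [k _]|_ [k _ <-]]; first by exists (Posz i).
  rewrite -expgzM -expgzN -expgzD => /xi e; apply/val_inj/eqP => /=.
  rewrite -eqz_nat -subr_eq0.
  have := ltn_ord i; have := ltn_ord j => li lj.
  have : (n %| (Posz j - Posz i)%R)%Z.
    by apply/dvdzP; exists k; rewrite mulrC e addrC.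
  rewrite dvdzE; case: (ltngtP i j) => [ij|ij|->]; last by rewrite subrr.
    by move/dvdn_leq; lia.
  by move/dvdn_leq; lia.
have lt : (`|(k %% n)%Z| < `|n|)%N.
  by rewrite -ltz_nat gez0_abs ?modz_ge0 ?ltz_mod //; apply/eqP.
exists (Ordinal lt); exists (k %/ n)%Z => //.
rewrite -[nat_of_ord (Ordinal lt)]/(`|(k %% n)%Z|%N).
rewrite gez0_abs ?modz_ge0 //; last exact/eqP.
rewrite -expgzM -expgzN -expgzD; congr (_ ^z _).
by apply: (addrI (k %% n)%Z); rewrite addrA subrr add0r addrC mulrC -divz_eq.
Qed.

Lemma has_index_conj g H K d : has_index H K d ->
  has_index (conj_by g H) (conj_by g K) d.
Proof.
case=> T [f [[Hf inj_f surj_f] <-]].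
exists T, (fun t => g * f t * g^-1); split=> //; split=> [t|t u|_ [h Hh <-]].
- by exists (f t).
- case=> k Kk e; apply: inj_f; suff -> : (f t)^-1 * f u = k by [].
  apply: (mulgI g); apply: (mulIg g^-1); rewrite e.
  by rewrite !invgM invgK !mulgA mulgVK.
have [t Kt] := surj_f h Hh; exists t; exists ((f t)^-1 * h) => //.
by rewrite !invgM invgK !mulgA mulgVK.
Qed.

End Index.

Section Modulus.
Variable G : groupType.
Implicit Types (H K L : set G) (x y g : G) (m n : int).
Local Open Scope group_scope.

Lemma has_index_gt0 H K d : subgroup H -> has_index H K d -> (0 < d)%N.
Proof.
move=> sH [T [f [[_ _ surj_f] <-]]].
by have [t _] := surj_f 1 (subgroup1 sH); apply/card_gt0P; exists t.
Qed.

Lemma has_index_intermediate H K L d : subgroup K -> subgroup L ->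
  L `<=` K -> K `<=` H -> has_index H L d ->
  (exists d1, has_index H K d1) /\ (exists d2, has_index K L d2).
Proof.
move=> sK sL LK KH HL; split; apply: has_index_finite => //; last first.
  apply: sub_finite_set (finite_has_index sL HL) => _ [k Kk <-].
  by exists k => //; apply: KH.
case: HL => T [f [[Hf inj_f surj_f] _]].
apply: sub_finite_set
  (finite_image (fun t => [set f t * k | k in K]) (@finite_finset T setT)).
move=> _ [h Hh <-]; have [t Kt] := surj_f h Hh; exists t => //.
by apply/(lcoset_eq _ _ sK)/LK.
Qed.

Lemma power_of_finite_index x K d : subgroup K -> has_index (cyclic_set x) K d ->
  exists2 k, k <> 0%R & K (x ^z k).
Proof.
move=> sK [T [f [[Hf inj_f surj_f] _]]].
have /choice[r Hr] (i : 'I_#|T|.+1) : exists t, K ((f t)^-1 * x ^z (Posz i)).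
  by apply: surj_f; exists (Posz i).
have /injectivePn[i [j ij rij]] : ~~ injectiveb r.
  apply/negP => /injectiveP/leq_card; rewrite card_ord; lia.
exists (Posz j - Posz i)%R.
  by apply/eqP; rewrite subr_eq0; apply: contra ij => /eqP[/val_inj->].
rewrite addrC expgzD expgzN.
have := subgroupM sK (subgroupV sK (Hr i)) (Hr j).
by rewrite rij invgM invgK -!mulgA mulVKg.
Qed.

Lemma cyclic_set_sub x H : subgroup H -> H x -> cyclic_set x `<=` H.
Proof.
move=> sH Hx _ [n _ <-].
elim/int_rect: n => [|n IH|n IH]; first exact: subgroup1.
  by rewrite -addn1 PoszD expgzS; apply: subgroupM.
rewrite -addn1 PoszD opprD expgzB1; apply: subgroupM => //; exact: subgroupV.
Qed.

(** [H] and its conjugate both contain the subgroup [W] generated by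
    [x ^z (k n)], for a suitable [k], and the modulus is the quotient of the
    indices of [W] in them: with [D = [H : x ^z k]], these are [D |n|] and
    [D |m|], as [W] is also generated by the conjugate of [x ^z (k m)]. *)
Lemma modulus_conj_power H x g m n : infinite_order x -> subgroup H ->
  commensurable H (cyclic_set x) -> conj_power x g m n ->
  modulus H g = (`|n|%N%:R / `|m|%N%:R)%R.
Proof.
move=> xi sH [HK KH] [m0 n0 gmn].
have sx := cyclic_subgroup x; have sHx := subgroupI sH sx.
have [d1 Hd1] := has_index_finite sHx HK.
have [dx Hdx] := has_index_finite sHx KH.
have [k k0 [Hxk _]] := power_of_finite_index sHx Hdx.
pose a := x ^z k; have ai : infinite_order a by exact: infinite_orderX.
have sa := cyclic_subgroup a.
have aHx : cyclic_set a `<=` H `&` cyclic_set x.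
  by apply: cyclic_set_sub => //; split=> //; exists k.
have [_ [d2 Hd2]] := has_index_intermediate sHx sa aHx (@subIsetr _ _ _)
  (has_index_cyclic xi k0).
have HD := has_indexM sH sHx (@subIsetl _ _ _) aHx Hd1 Hd2.
set D := (d1 * d2)%N in HD; have D0 := has_index_gt0 sH HD.
have ga : g * a ^z m * g^-1 = a ^z n.
  by rewrite /a expgzC expgzJ gmn expgzC.
pose W := cyclic_set (a ^z n); have sW : subgroup W by exact: cyclic_subgroup.
have sgH := conj_by_subgroup g sH.
have Wa : W `<=` cyclic_set a by apply: cyclic_set_sub => //; exists n.
have aH : cyclic_set a `<=` H by move=> y /aHx[].
have Wn : has_index H W (D * `|n|)%N.
  by apply: has_indexM HD (has_index_cyclic ai n0).
have Wga : W `<=` conj_by g (cyclic_set a).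
  rewrite /W -ga; apply: cyclic_set_sub; first exact: conj_by_subgroup.
  by exists (a ^z m) => //; exists m.
have gaH : conj_by g (cyclic_set a) `<=` conj_by g H.
  by move=> _ [y /aH Hy <-]; exists y.
have Wm : has_index (conj_by g H) W (D * `|m|)%N.
  apply: has_indexM (has_index_conj g HD) _ => //; first exact: conj_by_subgroup.
  rewrite conj_by_cyclic /W -ga expgzJ; apply: has_index_cyclic => //.
  exact: infinite_orderJ.
pose I := H `&` conj_by g H; have sI : subgroup I by exact: subgroupI.
have WI : W `<=` I by move=> y Wy; split; [exact/aH/Wa | exact/gaH/Wga].
have [[d3 H3] [d4 H4]] := has_index_intermediate sI sW WI (@subIsetl _ _ _) Wn.
have [[d5 H5] _] := has_index_intermediate sI sW WI (@subIsetr _ _ _) Wm.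
have e1 : (d3 * d4 = D * `|n|)%N.
  rewrite -(has_index_subg sW Wn); apply/esym/has_index_subg => //.
  by apply: has_indexM H3 H4 => //; exact: subIsetl.
have e2 : (d5 * d4 = D * `|m|)%N.
  rewrite -(has_index_subg sW Wm); apply/esym/has_index_subg => //.
  by apply: has_indexM H5 H4 => //; exact: subIsetr.
rewrite /modulus (has_index_subg sI H3) (has_index_subg sI H5).
have m1 : (`|m|%N%:R != 0 :> rat)%R by rewrite pnatr_eq0 absz_eq0; apply/eqP.
have d50 : (d5%:R != 0 :> rat)%R.
  by rewrite pnatr_eq0 -lt0n; apply: has_index_gt0 H5.
apply/eqP; rewrite eqr_div // -!natrM eqr_nat.
have d40 := has_index_gt0 sI H4.
rewrite -(eqn_pmul2r d40) -(eqn_pmul2l D0); apply/eqP; nia.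
Qed.

Definition no_integral_modulus x : Prop :=
  forall g m n, conj_power x g m n -> (m %| n)%Z -> `|m|%N = `|n|%N.

Lemma no_integral_modulusP (q : G -> rat) H x : infinite_order x -> subgroup H ->
  commensurable H (cyclic_set x) -> (forall g, q g = modulus H g) ->
  range q `&` [set r : rat | r \is a Num.int] = [set 1%R] ->
  no_integral_modulus x.
Proof.
move=> xi sH Hx qE q1 g m n gmn mn.
have [m0 n0 _] := gmn.
have m1 : (`|m|%N%:R != 0 :> rat)%R by rewrite pnatr_eq0 absz_eq0; apply/eqP.
have qg : q g = (`|n|%N%:R / `|m|%N%:R)%R by rewrite qE (modulus_conj_power xi sH Hx gmn).
have : [set 1%R] (q g).
  rewrite -q1; split; first by exists g.
  have := mn; rewrite dvdzE => /dvdnP[k nk].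
  by rewrite /= qg nk natrM mulfK // natr_int.
move=> /= /eqP; rewrite qg -(inj_eq (mulIf m1)) mulfVK // mul1r eqr_nat.
by move/eqP.
Qed.

End Modulus.

(** * Conjugates of powers and Dickson's lemma *)

(** Take at each stage a later index at which [f] is minimal. *)
Lemma nondecreasing_subseq (f : nat -> nat) : exists2 phi : nat -> nat,
  {homo phi : i j / (i < j)%N} & {homo f \o phi : i j / (i <= j)%N}.
Proof.
have tail k : exists j, (k <= j)%N /\ forall i, (k <= i)%N -> (f j <= f i)%N.
  have ex : exists v, `[< exists2 j, (k <= j)%N & f j = v >].
    by exists (f k); apply/asboolP; exists k.
  case: (ex_minnP ex) => v /asboolP[j kj <-] minv.
  exists j; split=> // i ki; apply: minv; apply/asboolP; by exists i.
have [next nextP] := choice tail.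
pose phi := fix phi n := if n is n'.+1 then next (phi n').+1 else next 0%N.
have phiS n : (phi n < phi n.+1)%N by case: (nextP (phi n).+1).
exists phi; first exact: (homo_ltn ltn_trans).
apply: homo_leq; [exact: leqnn | exact: leq_trans | move=> n /=].
have [k] : exists k, phi n = next k /\ (k <= phi n)%N.
  by case: n => [|n]; [exists 0%N | exists (phi n).+1; rewrite phiS].
case=> phin kn; have le := (nextP k).2 (phi n.+1); rewrite -phin in le; apply: le.
exact: leq_trans kn (ltnW (phiS n)).
Qed.

(** Dickson's lemma, for finitely many coordinates. *)
Lemma nondecreasing_subseqs (I : eqType) (ps : seq I) (f : I -> nat -> nat) :
  exists2 phi : nat -> nat, {homo phi : i j / (i < j)%N} &
    forall p, p \in ps -> {homo f p \o phi : i j / (i <= j)%N}.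
Proof.
elim: ps => [|p ps [phi phi_lt phi_le]]; first by exists id.
have [psi psi_lt psi_le] := nondecreasing_subseq (f p \o phi).
exists (phi \o psi) => [i j ij|r /=]; first exact/phi_lt/psi_lt.
rewrite inE => /predU1P[->|rps] i j ij; first exact: psi_le.
by apply: phi_le => //; apply: ltnW_homo psi_lt _ _ ij.
Qed.

Lemma dvdn_logn m n : (0 < m)%N -> (0 < n)%N ->
  (forall p, prime p -> logn p m <= logn p n)%N -> (m %| n)%N.
Proof.
move=> m0 n0 mn; apply/(dvdn_partP n m0) => p.
rewrite mem_primes => /andP[pp _].
by rewrite p_part pfactor_dvdn // mn.
Qed.

Lemma strictly_increasing_ge (phi : nat -> nat) :
  {homo phi : i j / (i < j)%N} -> forall k, (k <= phi k)%N.
Proof. by move=> phi_lt; elim=> // k IH; apply: leq_ltn_trans IH (phi_lt _ _ _). Qed.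

(** An unbounded [P] would contain an increasing sequence; by Dickson's lemma for
    the exponents of the primes of [N], one term would divide a later one. *)
Lemma dvdn_antichain_bounded (P : nat -> Prop) (N : nat) :
  (forall m, P m -> (0 < m)%N) ->
  (forall m p, P m -> prime p -> (p %| m)%N -> (p \in primes N)) ->
  (forall m n, P m -> P n -> (m %| n)%N -> m = n) ->
  exists B, forall m, P m -> (m <= B)%N.
Proof.
move=> P0 Ppr Pac; apply: contrapT => unb.
have /choice[u uP] i : exists m, P m /\ (i < m)%N.
  apply: contrapT => H; apply: unb; exists i => m Pm; rewrite leqNgt.
  by apply/negP => im; apply: H; exists m.
have [phi phi_lt phi_le] := nondecreasing_subseqs (primes N) (fun p i => logn p (u i)).
pose k := u (phi 0%N).
have uk : (u (phi 0%N) < u (phi k))%N.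
  by apply: leq_ltn_trans (proj2 (uP _)); apply: strictly_increasing_ge.
have [P1 _] := uP (phi 0%N); have [P2 _] := uP (phi k).
suff /(Pac _ _ P1 P2) e : (u (phi 0%N) %| u (phi k))%N by rewrite e ltnn in uk.
apply: dvdn_logn; [exact: P0 | exact: P0 | move=> p pp].
have [/phi_le|pN] := boolP (p \in primes N); first exact.
rewrite lognE; case: ifP => // /and3P[_ _ /(Ppr _ _ P1 pp) pN'].
by rewrite pN' in pN.
Qed.

Section Sources.
Variable G : groupType.
Implicit Types (x y g : G) (m n : int).
Local Open Scope group_scope.

Definition commensurated x := forall g, exists m n, conj_power x g m n.

(** The [p]-adic valuation of the modulus is a homomorphism, so it vanishes as
    soon as it does on the generators. Hence only finitely many primes occur in
    the moduli of a finitely generated group. *)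
Lemma conj_power_logn x (s : seq G) p :
  infinite_order x -> commensurated x ->
  (forall H, is_subgroup H -> [set` s] `<=` H -> H = setT) ->
  (forall g, g \in s -> exists m n, [/\ conj_power x g m n,
     ~~ (p %| `|m|%N)%N & ~~ (p %| `|n|%N)%N]) ->
  forall g m n, conj_power x g m n -> logn p `|m|%N = logn p `|n|%N.
Proof.
move=> xi xc gen_s s_p.
have pos m : m <> 0%R -> (0 < `|m|)%N by move=> m0; rewrite absz_gt0; apply/eqP.
pose H := [set g : G | forall m n, conj_power x g m n -> logn p `|m|%N = logn p `|n|%N].
suff HT : H = setT by move=> g; have : H g by rewrite HT.
apply: gen_s => [|g /s_p[m' [n' [gmn' pm pn]]] m n gmn].
  apply/is_subgroupP; split=> [m n|g h Hg Hh m n|g Hg m n /conj_powerV].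
  - by case=> _ _; rewrite mul1g invg1 mulg1 => /xi ->.
  - have [a [b hab]] := xc h => ghmn.
    have [a0 b0 _] := hab; have [m0 n0 ghe] := ghmn.
    have : conj_power x g (b * m)%R (n * a)%R.
      split; try exact: mulz_neq0.
      rewrite !expgzM -ghe; case: hab => _ _ <-.
      by rewrite -!expgzJ expgzC invgM !mulgA.
    move/Hg; have := Hh _ _ hab; rewrite !abszM !lognM ?pos //; lia.
  - by rewrite invgK => /Hg.
have := conj_power_ratio xi gmn gmn'; have [m0 n0 _] := gmn; have [m0' n0' _] := gmn'.
move/(congr1 (fun k => logn p `|k|%N)); rewrite !abszM !lognM ?pos //.
have -> : logn p `|m'|%N = 0%N by rewrite lognE (negbTE pm) !andbF.
by have -> : logn p `|n'|%N = 0%N; [rewrite lognE (negbTE pn) !andbF | lia].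
Qed.

(** If [x ^z M] and [x ^z M'] are both conjugate to [x ^z N] and [M] divides
    [M'], then [M' / M] is an integral modulus; so the possible [M] form an
    antichain for divisibility. *)
Lemma conj_power_bounded x N :
  finitely_generated G -> infinite_order x -> commensurated x ->
  no_integral_modulus x ->
  exists B, forall g M, conj_power x g M N -> (`|M| <= B)%N.
Proof.
move=> [s gen_s] xi xc xq.
have pos m : m <> 0%R -> (0 < `|m|)%N by move=> m0; rewrite absz_gt0; apply/eqP.
have /choice[mn mnP] (g : G) : exists mn : int * int, conj_power x g mn.1 mn.2.
  by have [m [n gmn]] := xc g; exists (m, n).
pose N0 := (`|N| * \prod_(g <- s) (`|(mn g).1| * `|(mn g).2|))%N.
have [] := @dvdn_antichain_bounded
  (fun k : nat => exists g M, conj_power x g M N /\ k = `|M|%N) N0.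
- by move=> _ [g [M [[M0 _ _] ->]]]; apply: pos.
- move=> _ p [g [M [gMN ->]]] pp pM; have [M0 N00 _] := gMN.
  have N0pos : (0 < N0)%N.
    rewrite muln_gt0 pos //= prodn_cond_gt0 // => h _.
    by have [? ? _] := mnP h; rewrite muln_gt0 !pos.
  rewrite mem_primes pp N0pos /=; apply/negPn/negP => pN0.
  have : logn p `|M|%N = logn p `|N|%N.
    apply: (conj_power_logn xi xc gen_s) gMN => h hs.
    exists (mn h).1, (mn h).2; split=> //; apply: contra pN0 => ph; apply: dvdn_mull;
      rewrite (big_rem h) //=; apply: dvdn_mulr; [exact: dvdn_mulr | exact: dvdn_mull].
  rewrite (lognE p `|M|) pp pM. rewrite (pos _ M0) /= => e.
  case/negP: pN0; apply: dvdn_mulr.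
  by move: e; rewrite (lognE p `|N|) pp (pos _ N00) /=; case: ifP.
- move=> _ _ [g [M [gMN ->]]] [g' [M' [gMN' ->]]] MM'.
  apply: (xq (g'^-1 * g)) => //; have [M0 N00 e] := gMN; have [M0' _ e'] := gMN'.
  split=> //; rewrite invgM invgK !mulgA -(mulgA _ g) -(mulgA _ _ g^-1) e -e'.
  by rewrite !mulgA mulVg mul1g mulgVK.
by move=> B BP; exists B => g M gMN; apply: BP; exists g, M.
Qed.

End Sources.

(** * Reduced paths and half-trees *)

Lemma In_cat T (x : T) s t : List.In x (s ++ t) <-> List.In x s \/ List.In x t.
Proof. elim: s => [|y s IH] /=; tauto. Qed.

Lemma In_split T (x : T) s : List.In x s -> exists s1 s2, s = s1 ++ x :: s2.
Proof.
elim: s => // y s IH [->|/IH[s1 [s2 ->]]]; first by exists [::], s.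
by exists (y :: s1), s2.
Qed.

Lemma In_map T U (f : T -> U) y s : List.In y (map f s) -> exists2 x, List.In x s & f x = y.
Proof.
elim: s => // x s IH [<-|/IH[x' xs <-]]; first by exists x => //; left.
by exists x' => //; right.
Qed.

Section Paths.
Variable A : graph.
Implicit Types (S : set (edge A)) (u v w : vertex A) (e f : edge A) (p q : seq (edge A)).

Lemma d1_bar e : d1 (bar e) = d0 e.
Proof. by rewrite -d0_bar barK. Qed.

Lemma bar_inj : injective (@bar A).
Proof. exact: can_inj (@barK A). Qed.

Definition rev_path p : seq (edge A) := rev (map (@bar A) p).

Lemma edge_path_cat S u v w p q :
  edge_path S u v p -> edge_path S v w q -> edge_path S u w (p ++ q).
Proof.
elim: p u => [u -> //|e p IH u [Se eu pv] qw]; split=> //; exact: IH.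
Qed.

Lemma edge_path_split S u w p q :
  edge_path S u w (p ++ q) -> exists v, edge_path S u v p /\ edge_path S v w q.
Proof.
elim: p u => [u qw|e p IH u [Se eu /IH[v [pv qw]]]]; first by exists u.
by exists v.
Qed.

Lemma edge_path_sub S S' u w p : S `<=` S' -> edge_path S u w p -> edge_path S' u w p.
Proof. by move=> SS'; elim: p u => // e p IH u [/SS' Se eu /IH]. Qed.

Lemma edge_path_rev S u w p : (forall e, S e -> S (bar e)) ->
  edge_path S u w p -> edge_path S w u (rev_path p).
Proof.
move=> Sbar; elim: p u => [u -> //|e p IH u [Se eu /IH pw]].
rewrite /rev_path /= rev_cons -cats1; apply: edge_path_cat pw _; split.
- exact: Sbar.
- by rewrite d0_bar.
- by rewrite d1_bar.
Qed.

Lemma edge_path_revT u w p : edge_path setT u w p -> edge_path setT w u (rev_path p).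
Proof. exact: edge_path_rev. Qed.

Lemma edge_path_In S u w p e : edge_path S u w p -> List.In e p -> S e.
Proof. by elim: p u => // f p IH u [Sf _ /IH pw] [<-|/pw]. Qed.

Lemma edge_path_restrict S S' u w p : edge_path S u w p ->
  (forall e, List.In e p -> S' e) -> edge_path S' u w p.
Proof.
elim: p u => // f p IH u [Sf fu pw] pS'; split=> //; first by apply: pS'; left.
by apply: IH => // e ep; apply: pS'; right.
Qed.

Lemma reduced_path_nil : reduced_path ([::] : seq (edge A)).
Proof. by case=> [|? ?]. Qed.

Lemma reduced_path_tail e p : reduced_path (e :: p) -> reduced_path p.
Proof. by move=> ep p1 f p2 E; apply: (ep (e :: p1) f p2); rewrite E. Qed.

Lemma reduced_path_catl p q : reduced_path (p ++ q) -> reduced_path p.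
Proof.
by move=> pq p1 f p2 E; apply: (pq p1 f (p2 ++ q)); rewrite E -catA.
Qed.

Lemma reduced_path_catr p q : reduced_path (p ++ q) -> reduced_path q.
Proof. by elim: p => // e p IH /reduced_path_tail. Qed.

Lemma reduced_path_cons e p :
  (forall p', p <> bar e :: p') -> reduced_path p -> reduced_path (e :: p).
Proof.
by move=> ep rp [|f p1] f' p2 [fe E]; [by rewrite -fe in E; exact: ep E|exact: rp E].
Qed.

Lemma reduced_path_join p e f q : f <> bar e ->
  reduced_path (rcons p e) -> reduced_path (f :: q) -> reduced_path (rcons p e ++ f :: q).
Proof.
move=> ef; elim: p => [|e' p IH] /= rp rq.
  by apply: reduced_path_cons => // p' [].
apply: reduced_path_cons; last exact: IH (reduced_path_tail rp) rq.
move=> p'; case: p rp {IH} => [|f' p] /= rp [E _].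
  by apply: (rp [::] e' [::]); rewrite -E.
by apply: (rp [::] e' (rcons p e)); rewrite -E.
Qed.

Lemma rev_pathK p : rev_path (rev_path p) = p.
Proof.
rewrite /rev_path map_rev revK -map_comp -[RHS]map_id.
by apply: eq_map => e /=; rewrite barK.
Qed.

Lemma rev_path_cat p q : rev_path (p ++ q) = rev_path q ++ rev_path p.
Proof. by rewrite /rev_path map_cat rev_cat. Qed.

Lemma reduced_path_rev p : reduced_path p -> reduced_path (rev_path p).
Proof.
move=> rp p1 e p2 E; apply: (rp (rev_path p2) e (rev_path p1)).
by rewrite -[LHS]rev_pathK E rev_path_cat /rev_path /= !rev_cons barK -!cats1 -!catA.
Qed.

Lemma size_rev_path p : size (rev_path p) = size p.
Proof. by rewrite size_rev size_map. Qed.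

Lemma reduce_path S u w p : edge_path S u w p ->
  exists q, [/\ edge_path S u w q, reduced_path q & (size q <= size p)%N].
Proof.
have [n] := ubnP (size p); elim: n p => // n IH p; rewrite ltnS => pn pw.
have [rp|] := pselect (reduced_path p); first by exists p.
move=> nrp; have [p1 [e [p2 E]]] : exists p1 e p2, p = p1 ++ [:: e, bar e & p2].
  by apply: contrapT => H; apply: nrp => p1 e p2 E; apply: H; exists p1, e, p2.
move: pw pn; rewrite E => /edge_path_split[v [p1v [Se ev [_ _ p2w]]]].
rewrite d1_bar ev in p2w; rewrite size_cat /= => pn.
have [|q [qw rq qs]] := IH _ _ (edge_path_cat p1v p2w); first by rewrite size_cat; lia.
by exists q; split=> //; apply: leq_trans qs _; rewrite !size_cat /=; lia.
Qed.

Hypothesis treeA : is_tree A.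

Lemma tree_no_loop v p : edge_path setT v v p -> reduced_path p -> p = [::].
Proof. by case: treeA => _ _; apply. Qed.

Lemma tree_path u w : exists p, edge_path setT u w p /\ reduced_path p.
Proof.
case: treeA => _ [_ /(_ u w)[p /reduce_path[q [qw rq _]]]] _.
by exists q.
Qed.

(** Where two reduced paths first diverge, going back along one and forth along
    the other gives a reduced loop. *)
Lemma tree_path_unique u w p q :
  edge_path setT u w p -> reduced_path p ->
  edge_path setT u w q -> reduced_path q -> p = q.
Proof.
elim: p u q => [|e p IH] u q.
  by move=> /= <- _ qu /(tree_no_loop qu) ->.
case: q => [|f q].
  by move=> pw rp /= uw _; rewrite -uw in pw; apply: tree_no_loop pw rp.
have [<- pw rp [_ fu qw] rq|ef [_ eu pw] rp [_ fu qw] rq] := pselect (e = f).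
  case: pw => _ eu pw; congr (_ :: _).
  by apply: IH pw (reduced_path_tail rp) qw (reduced_path_tail rq).
suff : rev_path (e :: p) ++ f :: q = [::] by case: (rev_path _).
have epw : edge_path setT u w (e :: p) by [].
apply: (@tree_no_loop w).
  by apply: edge_path_cat (edge_path_revT epw) _; split.
have := reduced_path_rev rp; rewrite /rev_path /= rev_cons => rp'.
by apply: reduced_path_join => //; rewrite barK => fe; apply: ef.
Qed.

Lemma reduced_path_shortest u w p q : edge_path setT u w p -> reduced_path p ->
  edge_path setT u w q -> (size p <= size q)%N.
Proof.
move=> pw rp /reduce_path[q' [qw' rq' qs]].
by rewrite (tree_path_unique pw rp qw' rq').
Qed.

(** Removing the edge [e] from the tree leaves two components; [half e] is the
    one containing the end of [e]. *)
Definition half e v : bool :=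
  `[< exists p, edge_path [set f | f <> e /\ f <> bar e] (d1 e) v p >].

Lemma half_d1 e : half e (d1 e).
Proof. by apply/asboolP; exists [::]. Qed.

Lemma half_path e v : half e v ->
  exists p, edge_path setT (d0 e) v (e :: p) /\ reduced_path (e :: p).
Proof.
move=> /asboolP[p /reduce_path[q [qv rq _]]]; exists q; split.
  by split=> //; apply: edge_path_sub qv.
apply: reduced_path_cons rq => p' E.
by move: qv; rewrite E => -[[]].
Qed.

Lemma half_d0 e : ~~ half e (d0 e).
Proof. by apply/negP => /half_path[p [pv /(tree_no_loop pv)]]. Qed.

Lemma half_step e f : f <> e -> f <> bar e -> half e (d0 f) = half e (d1 f).
Proof.
move=> fe feb; apply/asboolP/asboolP => -[p pv].
  by exists (p ++ [:: f]); apply: edge_path_cat pv _.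
exists (p ++ [:: bar f]); apply: edge_path_cat pv _; split; last by rewrite /= d1_bar.
  by split=> [E|/bar_inj //]; apply: feb; rewrite -E barK.
by rewrite d0_bar.
Qed.

Lemma half_separates e v w p : edge_path setT v w p -> half e v != half e w ->
  List.In e p \/ List.In (bar e) p.
Proof.
elim: p v => [v -> |f p IH v [_ <- pw]]; first by rewrite eqxx.
have [->|fe] := pselect (f = e); first by left; left.
have [->|feb] := pselect (f = bar e); first by right; left.
by rewrite (half_step fe feb) => /(IH _ pw) [ep|ep]; [left|right]; right.
Qed.

Lemma half_bar e v : half (bar e) v = ~~ half e v.
Proof.
have [p [pv _]] := tree_path (d0 e) v.
suff H w : edge_path setT w v p ->
    half (bar e) w = ~~ half e w -> half (bar e) v = ~~ half e v.
  by apply: H pv _; rewrite (negbTE (half_d0 e)) -d1_bar half_d1.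
elim: p w {pv} => [w -> //|f p IH w [_ <- pv] H]; apply: IH pv _.
have [->|fe] := pselect (f = e).
  by rewrite half_d1 -d0_bar (negbTE (half_d0 _)).
have [->|feb] := pselect (f = bar e).
  by rewrite half_d1 d1_bar (negbTE (half_d0 _)).
by rewrite -!half_step ?barK.
Qed.

(** The reduced path to [v] from the common origin has only one first edge. *)
Lemma half_disjoint e f v : d0 e = d0 f -> half e v -> half f v -> e = f.
Proof.
move=> ef /half_path[p [pv rp]] /half_path[q [qv rq]].
by rewrite -ef in qv; case: (tree_path_unique pv rp qv rq).
Qed.

(** A second crossing of [e] would close a reduced loop, so the rest of the path
    stays on the side of [e] that it has reached. *)
Lemma reduced_path_half u w p q e : edge_path setT u w (p ++ e :: q) ->
  reduced_path (p ++ e :: q) -> ~~ half e u /\ half e w.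
Proof.
have aux u' w' q' e' : edge_path setT u' w' (e' :: q') -> reduced_path (e' :: q') ->
    half e' w'.
  move=> pq rq; have [_ _ qw] := pq; apply/asboolP; exists q'.
  apply: (edge_path_restrict qw) => f fq.
  have [q1 [q2 E]] := In_split fq.
  have E' : e' :: q' = (e' :: q1) ++ f :: q2 by rewrite E.
  rewrite E' in pq rq; split=> ff; subst f.
    have [v [pv [_ ev _]]] := edge_path_split pq.
    have [_ eu _] := pv; rewrite -eu ev in pv.
    by have := tree_no_loop pv (reduced_path_catl rq).
  have [_ _ /edge_path_split[v [pv [_ ev _]]]] := pq.
  rewrite -ev d0_bar in pv.
  have := tree_no_loop pv (reduced_path_catl (reduced_path_tail rq)).
  by move=> q10; apply: (rq [::] e' q2); rewrite q10.
move=> pw rp; have [v [pv qw]] := edge_path_split pw.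
split; last exact: aux qw (reduced_path_catr rp).
have pe : edge_path setT u (d1 e) (rcons p e).
  by rewrite -cats1; case: qw => _ ev _; apply: edge_path_cat pv _.
rewrite -half_bar; apply: (aux (d1 e) _ (rev_path p)).
  have := edge_path_revT pe.
  by rewrite /rev_path map_rcons rev_rcons; apply.
have := @reduced_path_catl (rcons p e) q; rewrite -cats1 -catA => /(_ rp)/reduced_path_rev.
by rewrite /rev_path map_cat rev_cat.
Qed.

End Paths.

(** * Automorphisms of a tree without fixed vertices *)

Section TreeActions.
Variables (G : groupType) (T : Gtree G).
Implicit Types (u v w : vertex T) (e f : edge T) (p q : seq (edge T)) (g h z : G).
Local Open Scope group_scope.
Notation actp g p := (map (actE (g : G)) (p : seq (edge T))).

Let treeT : is_tree T := gt_tree T.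

Lemma actVK g v : actV g^-1 (actV g v) = v.
Proof. by rewrite -actVM mulVg actV1. Qed.

Lemma actEK g e : actE g^-1 (actE g e) = e.
Proof. by rewrite -actEM mulVg actE1. Qed.

Lemma act_d1 g e : d1 (actE g e) = actV g (d1 e).
Proof. by rewrite -d0_bar act_bar act_d0 d0_bar. Qed.

Lemma edge_path_act (S S' : set (edge T)) g u w p :
  (forall e, S e -> S' (actE g e)) ->
  edge_path S u w p -> edge_path S' (actV g u) (actV g w) (actp g p).
Proof.
move=> SS'; elim: p u => [u -> //|e p IH u [Se eu pw]] /=; split; first exact: SS'.
  by rewrite act_d0 eu.
by rewrite act_d1; apply: IH.
Qed.

Lemma edge_path_actT g u w p : edge_path setT u w p ->
  edge_path setT (actV g u) (actV g w) (actp g p).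
Proof. exact: edge_path_act. Qed.

Lemma actp1 p : actp 1 p = p.
Proof. by rewrite -[RHS]map_id; apply: eq_map => e; rewrite actE1. Qed.

Lemma actpM g h p : actp (g * h) p = actp g (actp h p).
Proof. by rewrite -map_comp; apply: eq_map => e /=; rewrite actEM. Qed.

Lemma reduced_path_act g p : reduced_path p -> reduced_path (actp g p).
Proof.
move=> rp p1 e p2 E; apply: (rp (actp g^-1 p1) (actE g^-1 e) (actp g^-1 p2)).
by rewrite -[LHS]actp1 -(mulVg g) actpM E map_cat /= act_bar.
Qed.

Lemma half_act g e v : half (actE g e) (actV g v) = half e v.
Proof.
have aux h f w : half f w -> half (actE h f) (actV h w).
  move=> /asboolP[p pw]; apply/asboolP; exists (actp h p).
  rewrite act_d1; apply: edge_path_act pw => e' [ff fb]; split=> E.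
    by apply: ff; rewrite -(actEK h e') E actEK.
  by apply: fb; rewrite -(actEK h e') E act_bar actEK.
by apply/idP/idP => [/(aux g^-1)|/aux //]; rewrite actEK actVK.
Qed.

(** An automorphism fixing the ends of a reduced path fixes its edges, by
    uniqueness of the path; so vertex stabilizers meet in edge stabilizers. *)
Lemma fix_separating g e u w : actV g u = u -> actV g w = w ->
  half e u != half e w -> actE g e = e.
Proof.
move=> gu gw euw; have [p [pw rp]] := tree_path treeT u w.
have gp : actp g p = p.
  have := edge_path_actT g pw; rewrite gu gw => gpw.
  exact: (tree_path_unique treeT gpw (reduced_path_act (g := g) rp) pw rp).
have fixp : forall f, List.In f p -> actE g f = f.
  elim: p gp {pw rp} => // f p IH [gf gp] f' [<- //|]; exact: IH.
have [|/fixp] := half_separates pw euw; first exact: fixp.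
by rewrite -act_bar => /bar_inj.
Qed.

Section Axis.
Variable z : G.
(** [p] is a fundamental domain of an axis of [z]: a path from [v] to [z v]
    whose successive translates join without backtracking. *)
Definition is_axis v p : Prop :=
  [/\ edge_path setT v (actV z v) p, (0 < size p)%N &
      forall q, reduced_path q ->
        (forall e q', q = e :: q' -> exists p', actp z p = e :: p') ->
        reduced_path (p ++ q)].

(** Take [v] of minimal displacement: a backtrack where [p] meets its translate
    would give a vertex of smaller displacement, or an inversion. *)
Lemma axis_exists : inhabited (vertex T) -> (forall v, actV z v <> v) ->
  exists v p, is_axis v p.
Proof.
case=> v0 z_free.
pose P n := `[< exists v p, [/\ edge_path setT v (actV z v) p & size p = n] >].
have exP : exists n, P n.
  have [p [pv _]] := tree_path treeT v0 (actV z v0).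
  by exists (size p); apply/asboolP; exists v0, p.
case: (ex_minnP exP) => _ /asboolP[v [p [pv <-]]] minp {exP}.
have minp' v' p' : edge_path setT v' (actV z v') p' -> (size p <= size p')%N.
  by move=> pv'; apply: minp; apply/asboolP; exists v', p'.
have rp : reduced_path p.
  move=> p1 e p2 E; move: pv; rewrite E => /edge_path_split[v1 [pv1 [_ ev [_ _ pv2]]]].
  rewrite d1_bar ev in pv2.
  by have := minp' _ _ (edge_path_cat pv1 pv2); rewrite E !size_cat /=; lia.
have p0 : (0 < size p)%N.
  by case: p pv {minp minp' rp} => // vz; case: (z_free _ (esym vz)).
exists v, p; split=> // q rq qP.
case: q rq qP => [|f q] rq; first by rewrite cats0.
move=> /(_ _ _ erefl)[p' zp]; case/lastP: p => [|p e] // in pv rp p0 zp minp minp' *.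
apply: reduced_path_join => // fE.
case: p => [|e1 p] in pv rp p0 zp minp minp' *.
  by case: zp => zf _; apply: (@no_inversion _ T z e); rewrite zf.
case: zp => zf _; move: pv; rewrite -cats1 => -[_ ev].
move=> /edge_path_split[v1 [pv1 [_ ev1 _]]].
suff /minp' : edge_path setT (d1 e1) (actV z (d1 e1)) p.
  by rewrite size_rcons /=; lia.
by rewrite -act_d1 zf fE d1_bar ev1.
Qed.

Variables (v : vertex T) (p : seq (edge T)).
Hypothesis axis_vp : is_axis v p.

Fixpoint axis n : seq (edge T) := if n is n'.+1 then p ++ actp z (axis n') else [::].

Lemma axis_path n : edge_path setT v (actV (z ^+ n) v) (axis n).
Proof.
elim: n => [|n IH]; first by rewrite /= actV1.
have [axis_p _ _] := axis_vp.
by rewrite expgS actVM; apply: edge_path_cat axis_p (edge_path_actT _ IH).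
Qed.

Lemma axis_reduced n : reduced_path (axis n).
Proof.
have [_ p_neq0 join] := axis_vp.
elim: n => [|n IH] /=; first exact: reduced_path_nil.
apply: join; first exact: reduced_path_act.
case: n {IH} => [|n] //= e q'; case: p p_neq0 => // f p' _ [<- _].
by exists (actp z p').
Qed.

Lemma axisD m n : axis (m + n) = axis m ++ actp (z ^+ m) (axis n).
Proof.
elim: m => [|m IH]; first by rewrite /= actp1.
by rewrite addSn /= IH map_cat expgS actpM catA.
Qed.

Lemma size_axis n : (n <= size (axis n))%N.
Proof.
have [_ p_neq0 _] := axis_vp.
by elim: n => //= n IH; rewrite size_cat size_map; lia.
Qed.

Lemma expgz_nat n : z ^z (Posz n) = z ^+ n. Proof. by []. Qed.

Lemma axis_displacement (j : int) q :
  edge_path setT v (actV (z ^z j) v) q -> (`|j| <= size q)%N.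
Proof.
have aux n q' : edge_path setT v (actV (z ^+ n) v) q' -> (n <= size q')%N.
  move=> qv; apply: leq_trans (size_axis n) _.
  exact: (reduced_path_shortest treeT (axis_path n) (@axis_reduced n) qv).
case: j => n /=; first exact: aux.
move=> qv; have := edge_path_revT (edge_path_actT (z ^+ n.+1) qv).
rewrite -actVM mulgV actV1 => /aux.
by rewrite size_rev_path size_map.
Qed.

Lemma axis_half (e : edge T) (j : int) : List.In e p ->
  half e (actV (z ^z j) v) = (0 < j)%R.
Proof.
move=> ep; have [p1 [p2 E]] := In_split ep.
have neg n : half e (actV (z ^- n) v) = false.
  have := edge_path_actT (z ^- n) (axis_path n.+1).
  have := reduced_path_act (g := z ^- n) (@axis_reduced n.+1).
  rewrite -addn1 axisD map_cat -actpM mulVg actp1 /= cats0 E catA => rq qv.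
  by have [/negbTE] := reduced_path_half treeT qv rq.
case: j => [[|n]|n]; last exact: (neg n.+1).
  by have := neg 0%N; rewrite invg1.
have := axis_path n.+1; have := @axis_reduced n.+1; rewrite /= E -catA /= => rq qv.
by have [] := reduced_path_half treeT qv rq.
Qed.

End Axis.

(** Otherwise [z] has an axis, along which the displacement of the powers of
    [z ^z k] is unbounded, while these powers all fix [u]. *)
Lemma fixed_vertex_of_power z (k : int) u : k <> 0%R -> actV (z ^z k) u = u ->
  exists v, actV z v = v.
Proof.
move=> k0 zu; apply: contrapT => z_free.
have [v [p vp]] : exists v p, is_axis z v p.
  by apply: axis_exists => // v zv; apply: z_free; exists v.
have [q [qu _]] := tree_path treeT v u.
pose j := (k * Posz (size q + size q).+1)%R.
have ju : actV (z ^z j) u = u.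
  rewrite /j expgzM expgz_nat; elim: (_.+1) => [|n IH]; first by rewrite actV1.
  by rewrite expgS actVM IH.
have := edge_path_revT (edge_path_actT (z ^z j) qu); rewrite ju => qj.
have := axis_displacement vp (edge_path_cat qu qj).
by rewrite size_cat size_rev_path size_map /j abszM absz_nat; nia.
Qed.

Section Line.
Variable c : G.
Hypothesis c_free : forall v, actV c v <> v.
Hypothesis c_commensurated : commensurated c.
Hypothesis orbit_separated : forall e u,
  exists g h, half e (actV g u) != half e (actV h u).

Variables (v : vertex T) (p : seq (edge T)).
Hypothesis vp : is_axis c v p.

Definition on_axis e : Prop := exists i, exists2 f, List.In f p &
  e = actE (c ^z i) f \/ bar e = actE (c ^z i) f.

Lemma on_axis_bar e : on_axis e -> on_axis (bar e).
Proof.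
case=> i [f fp H]; exists i, f => //.
by rewrite barK; case: H; [right|left].
Qed.

Lemma on_axis_power i e : on_axis e -> on_axis (actE (c ^z i) e).
Proof.
case=> j [f fp [->|E]]; exists (i + j)%R, f => //; rewrite expgzD actEM; [by left|right].
by rewrite act_bar E.
Qed.

Lemma on_axis_p e : List.In e p -> on_axis e.
Proof. by move=> ep; exists 0%R, e => //; left; rewrite actE1. Qed.

Lemma on_axis_path i j :
  exists q, edge_path on_axis (actV (c ^z i) v) (actV (c ^z j) v) q.
Proof.
have [pv _ _] := vp.
have pv' : edge_path on_axis v (actV c v) p.
  by apply: edge_path_restrict pv _ => e; apply: on_axis_p.
suff H k : exists q, edge_path on_axis v (actV (c ^z k) v) q.
  have [q qv] := H (j - i)%R; exists (actp (c ^z i) q).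
  have := edge_path_act (g := c ^z i) (@on_axis_power i) qv.
  by rewrite -actVM -expgzD addrC subrK.
elim/int_rect: k => [|n [q qv]|n [q qv]]; first by exists [::]; rewrite actV1.
  exists (q ++ actp (c ^z Posz n) p); apply: edge_path_cat qv _.
  rewrite -addn1 PoszD expgzS actVM.
  by apply: edge_path_act pv' => e; apply: on_axis_power.
exists (q ++ rev_path (actp (c ^z (- Posz n.+1)%R) p)); apply: edge_path_cat qv _.
apply: (edge_path_rev on_axis_bar).
rewrite -[in (- Posz n)%R](subrK 1%R (- Posz n)%R) expgzS actVM -addn1 PoszD opprD.
by apply: edge_path_act pv' => e; apply: on_axis_power.
Qed.

(** The axes of [c] and [g c g^-1] stay at bounded distance from each other,
    as these elements have a common power; so they coincide. *)
Lemma on_axis_act_p g e : List.In e p -> on_axis (actE g e).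
Proof.
move=> ep; have [m [n gmn]] := c_commensurated g^-1.
have [q [qv _]] := tree_path treeT v (actV g^-1 v).
(* [e] is far from [c ^z j v] and from [c ^z j g^-1 v], which are at distance
   at most [size q], so it does not separate them once [j] is large. *)
have near j : half e (actV (c ^z j) (actV g^-1 v)) != half e (actV (c ^z j) v) ->
    (`|j| <= size q + size p)%N.
  rewrite eq_sym => sep.
  have [p1 [p2 E]] := In_split ep; have [pv _ _] := vp.
  have ppv := pv; rewrite E in pv; have [w [pw [_ ew _]]] := edge_path_split pv.
  have pe : edge_path setT v (d0 e) p1 by rewrite ew.
  have far f q1 : edge_path setT v (d0 f) q1 -> actE (c ^z j) f = e ->
      (`|j| <= size q1 + size p1)%N.
    move=> q1f fe; have := edge_path_revT (edge_path_actT (c ^z (- j)%R) pe).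
    rewrite -fe act_d0 -[actV (c ^z (- j)%R) (actV _ (d0 f))]actVM expgzN mulVg actV1.
    move=> /(edge_path_cat q1f); rewrite -expgzN => /(axis_displacement vp).
    by rewrite abszN size_cat size_rev_path size_map.
  have szp : size p = (size p1 + (size p2).+1)%N by rewrite E size_cat.
  have [ep'|ep'] := half_separates (edge_path_actT (c ^z j) qv) sep;
    have [f fq fe] := In_map ep'; have [q1 [q2 qE]] := In_split fq;
    move: (qv); rewrite qE => /edge_path_split[u [q1u [_ fu _]]].
  - by rewrite -fu in q1u; have := far _ _ q1u fe; rewrite size_cat /=; lia.
  - have q1f : edge_path setT v (d0 (bar f)) (q1 ++ [:: f]).
      by rewrite d0_bar; apply: edge_path_cat q1u _.
    have := far _ _ q1f; rewrite -act_bar fe barK => /(_ erefl).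
    by rewrite !size_cat /=; lia.
have [m' [n' [n'0 gmn']]] : exists m' n' : int, (0 < n')%R /\ conj_power c g^-1 m' n'.
  have [m0 n0 e'] := gmn; case: (ltrgt0P n) => n'0.
  - by exists m, n.
  - exists (- m)%R, (- n)%R; rewrite oppr_gt0; split=> //.
    split; try by apply/eqP; rewrite oppr_eq0; apply/eqP.
    by rewrite !expgzN -e' !invgM !invgK mulgA.
  - by case: n0.
pose K := Posz (size q + size p).+1.
have side (s : int) : `|s|%N = 1%N ->
    half (actE g e) (actV (c ^z (m' * (s * K))%R) v) = (0 < n' * (s * K))%R.
  move=> s1; rewrite -(axis_half vp _ ep).
  rewrite -[RHS](contraNeq (@near (n' * (s * K))%R)); last first.
    by rewrite -ltnNge !abszM s1 mul1n; nia.
  rewrite -[LHS](half_act g^-1) actEK; congr (half e _).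
  rewrite -!actVM; congr (actV _ v); have [_ _ e'] := gmn'.
  by rewrite !expgzM -e' -!expgzJ mulgVK.
have [r rP] := on_axis_path (m' * (1 * K))%R (m' * (-1 * K))%R.
have [||] := half_separates (edge_path_sub (@subsetT _ _) rP)
  (_ : half (actE g e) _ != half (actE g e) _).
- by rewrite !side //; nia.
- exact: edge_path_In rP.
- by move/(edge_path_In rP)/on_axis_bar; rewrite barK.
Qed.

Lemma on_axis_act g e : on_axis e -> on_axis (actE g e).
Proof.
case=> i [f fp [->|E]]; first by rewrite -actEM; apply: on_axis_act_p.
by rewrite -[e]barK E -act_bar -actEM; apply/on_axis_bar/on_axis_act_p.
Qed.

Lemma on_axis_to_v e : on_axis e -> exists q, edge_path on_axis (d0 e) v q.
Proof.
have [pv _ _] := vp.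
suff H i f : List.In f p ->
    (exists q, edge_path on_axis (actV (c ^z i) (d0 f)) v q) /\
    (exists q, edge_path on_axis (actV (c ^z i) (d1 f)) v q).
  case=> i [f fp [E|E]]; have [H0 H1] := H i f fp; first by rewrite E act_d0.
  by rewrite -d1_bar E act_d1.
move=> fp; have [p1 [p2 E]] := In_split fp.
have ppv := edge_path_restrict pv (@on_axis_p).
have := ppv; rewrite E => /edge_path_split[w [p1w [Lf wf _]]].
have [q qv] := on_axis_path i 0%R; rewrite actV1 in qv.
have conn w' q' : edge_path on_axis v w' q' ->
    exists q, edge_path on_axis (actV (c ^z i) w') v q.
  move=> /(edge_path_act (g := c ^z i) (@on_axis_power i))/(edge_path_rev on_axis_bar) q'v.
  by exists (rev_path (actp (c ^z i) q') ++ q); apply: edge_path_cat q'v qv.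
split; first by rewrite wf; apply: (conn _ p1).
by apply: (conn _ (p1 ++ [:: f])); apply: edge_path_cat p1w _.
Qed.

(** By minimality of the tree an edge separates two translates of [v], and the
    path between these lies on the axis. *)
Lemma on_axisT e : on_axis e.
Proof.
have [pv p0 _] := vp; have [g [h gh]] := orbit_separated e v.
have conn k : exists q, edge_path on_axis (actV k v) v q.
  case: p pv p0 (@on_axis_p) => // f p' [_ fv _] _ /(_ f (or_introl erefl)) Lf.
  by have := on_axis_to_v (on_axis_act k Lf); rewrite act_d0 fv.
have [q1 q1v] := conn g; have [q2 q2v] := conn h.
have qP := edge_path_cat q1v (edge_path_rev on_axis_bar q2v).
have [] := half_separates (edge_path_sub (@subsetT _ _) qP) gh.
  exact: edge_path_In qP.
by move/(edge_path_In qP)/on_axis_bar; rewrite barK.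
Qed.

(** The edges of an axis point towards one of its two ends, and two edges that
    leave a vertex cannot both point to the same end. *)
Lemma line_valence e1 e2 e3 : d0 e1 = d0 e2 -> d0 e1 = d0 e3 ->
  [\/ e1 = e2, e1 = e3 | e2 = e3].
Proof.
move=> e12 e13.
have sign e : exists b : bool, exists K : nat, forall j : int,
    (Posz K <= j)%R -> half e (actV (c ^z (if b then j else - j)%R) v).
  have [i [f fp fe]] := on_axisT e.
  have H (j : int) : half (actE (c ^z i) f) (actV (c ^z j) v) = (0 < j - i)%R.
    rewrite -(axis_half vp _ fp) -(half_act (c ^z i) f) -actVM -expgzD.
    by rewrite addrC subrK.
  case: fe => [->|fe]; first by exists true, `|i|.+1%N => j ij; rewrite H; lia.
  exists false, `|i|.+1%N => j ij; rewrite -[e]barK (half_bar treeT) fe H; lia.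
have [b1 [K1 H1]] := sign e1; have [b2 [K2 H2]] := sign e2; have [b3 [K3 H3]] := sign e3.
pose K := Posz (K1 + K2 + K3).
have {}H1 := H1 K ltac:(lia); have {}H2 := H2 K ltac:(lia); have {}H3 := H3 K ltac:(lia).
have e23 : d0 e2 = d0 e3 by rewrite -e12.
have /or3P[/eqP E|/eqP E|/eqP E] : [|| b1 == b2, b1 == b3 | b2 == b3].
- by case: b1 b2 b3 {H1 H2 H3} => [] [] [].
- by constructor 1; rewrite E in H1; exact: (half_disjoint treeT e12 H1 H2).
- by constructor 2; rewrite E in H1; exact: (half_disjoint treeT e13 H1 H3).
- by constructor 3; rewrite E in H2; exact: (half_disjoint treeT e23 H2 H3).
Qed.

End Line.
End TreeActions.

(** * Bass-Serre trees of reduced graphs of groups *)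

Section Stabilizers.
Variables (G : groupType) (T : Gtree G).
Implicit Types (x y : vertex T) (e f : edge T) (g h z w : G).
Local Open Scope group_scope.

Lemma stabV_act g x : stabV (actV g x) = conj_by g (stabV x).
Proof.
apply/seteqP; split=> [h /= hgx|_ [h hx <-]] /=.
  exists (g^-1 * h * g); first by rewrite /stabV /= !actVM hgx -actVM mulVg actV1.
  by rewrite !mulgA mulgV mul1g mulgK.
by rewrite /stabV /= -actVM mulgVK actVM hx.
Qed.

Lemma stabE_d0 e : stabE e `<=` stabV (d0 e).
Proof. by move=> h he; rewrite /stabV /= -act_d0 he. Qed.

Lemma stabE_d1 e : stabE e `<=` stabV (d1 e).
Proof. by move=> h he; rewrite /stabV /= -act_d1 he. Qed.

Lemma cyclic_set_gen z : cyclic_set z z.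
Proof. by exists 1%R. Qed.

Hypothesis gbsT : GBS_tree T.

Lemma stabV_gen x : exists2 z, stabV x = cyclic_set z & infinite_order z.
Proof. by case: (gbsT.1 x) => z; exists z. Qed.

Lemma stabV_infinite_order x z : stabV x = cyclic_set z -> infinite_order z.
Proof.
have [y -> yi] := stabV_gen x; move=> yz.
have [n _ zy] : cyclic_set z y by rewrite -yz; exact: cyclic_set_gen.
apply: infinite_orderP => m zm; case: (pselect (m = 0%R)) => // m0.
have : y ^z m = 1 by rewrite -zy expgzC zm expg1z.
by move/(infinite_order_neq0 yi).
Qed.

Lemma stabV_commens x y z w :
  stabV x = cyclic_set z -> stabV y = cyclic_set w -> commens z w.
Proof.
have [p [px _]] := tree_path (gt_tree T) x y.
elim: p x z px => [x z /= ->|e p IH _ z [_ <- py]] xz yw.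
  have zi := stabV_infinite_order xz.
  have [n _ zw] : cyclic_set w z by rewrite -yw xz; exact: cyclic_set_gen.
  exists 1%R, n; split=> // n0; rewrite n0 in zw.
  by have := @infinite_order_neq0 _ z 1%R zi; rewrite -{1}zw => /(_ erefl).
have [u d1u ui] := stabV_gen (d1 e); apply: commens_trans (IH _ _ py d1u yw).
have [t et ti] := gbsT.2 e.
have tt : stabE e t by rewrite et; exact: cyclic_set_gen.
have /stabE_d0 : stabE e t by []. have := stabE_d1 tt.
rewrite xz d1u => -[m _ um] [n _ zn].
have t0 k s : s ^z k = t -> k <> 0%R.
  move=> st k0; rewrite k0 in st.
  by have := @infinite_order_neq0 _ t 1%R ti; rewrite -{1}st => /(_ erefl).
by exists n, m; split; [exact: t0 zn | exact: t0 um | rewrite zn um].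
Qed.

Lemma stabV_commensurated x z : stabV x = cyclic_set z -> commensurated z.
Proof.
move=> xz g; have gxz : stabV (actV g x) = cyclic_set (g * z * g^-1).
  by rewrite stabV_act xz conj_by_cyclic.
have [m [n [m0 n0 e]]] := stabV_commens gxz xz.
by exists m, n; split=> //; rewrite expgzJ.
Qed.

End Stabilizers.

Section BassSerre.
Variable G : groupType.
Implicit Types (g h z w : G).
Local Open Scope group_scope.

(** [T] is a Bass-Serre tree of [A], with quotient map [(piV, piE)]: the last
    clause recovers the indices of [A] from the stabilizers. *)
Record bass_serre (A : Zgraph) (T : Gtree G)
    (piV : vertex T -> vertex A) (piE : edge T -> edge A) : Prop := BassSerre {
  piV_d0 : forall e, piV (d0 e) = d0 (piE e);
  piE_bar : forall e, piE (bar e) = bar (piE e);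
  piV_act : forall g x, piV (actV g x) = piV x;
  piE_act : forall g e, piE (actE g e) = piE e;
  piV_orbit : forall x y, piV x = piV y -> exists g, y = actV g x;
  piV_surj : forall v, exists x, piV x = v;
  piE_surj : forall a, exists e, piE e = a;
  bs_stabV : forall x : vertex T, infinite_cyclic (stabV x);
  bs_stabE : forall (e : edge T) z, stabV (d0 e) = cyclic_set z ->
    stabE e = cyclic_set (z ^z gi (piE e)) }.

Variables (A : Zgraph) (T : Gtree G).
Variables (piV : vertex T -> vertex A) (piE : edge T -> edge A).
Hypothesis bsT : bass_serre piV piE.
Implicit Types (x y : vertex T) (e f : edge T) (a b : edge A) (v : vertex A).

Let treeT : is_tree T := gt_tree T.

Lemma piV_d1 e : piV (d1 e) = d1 (piE e).
Proof. by rewrite -d0_bar (piV_d0 bsT) (piE_bar bsT) d0_bar. Qed.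

Lemma bs_GBS_tree : GBS_tree T.
Proof.
split; first exact: bs_stabV bsT.
move=> e; have [z ez zi] := bs_stabV bsT (d0 e).
exists (z ^z gi (piE e)); first exact: bs_stabE bsT e z ez.
by apply: infinite_orderX => //; apply: gi_neq0.
Qed.

Let gbsT := bs_GBS_tree.

Lemma lift_edge x a : d0 a = piV x -> exists e, d0 e = x /\ piE e = a.
Proof.
move=> ax; have [e ea] := piE_surj bsT a.
have [|g ge] := piV_orbit bsT (_ : piV (d0 e) = piV x); first by rewrite (piV_d0 bsT) ea.
by exists (actE g e); rewrite act_d0 (piE_act bsT).
Qed.

Lemma cyclic_setX_gen z (k : int) : infinite_order z -> cyclic_set (z ^z k) z ->
  `|k|%N = 1%N.
Proof.
move=> zi [n _]; rewrite -expgzM -{2}(expgz1 z) => /zi /(congr1 absz).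
by rewrite abszM => /eqP; rewrite muln_eq1 => /andP[/eqP].
Qed.

(** In a reduced graph an index one forces a loop, that is an element of [G]
    carrying one end of the edge to the other. *)
Lemma index1_translate e z : reduced A -> infinite_order z ->
  stabV (d0 e) = cyclic_set z -> actE z e = e -> exists g, d1 e = actV g (d0 e).
Proof.
move=> redA zi ez ze; apply: (piV_orbit bsT).
rewrite piV_d1 (piV_d0 bsT); apply: redA; apply: cyclic_setX_gen zi _.
by rewrite -(bs_stabE bsT ez).
Qed.

Lemma crossing_prefix e x y p : edge_path setT x y p -> ~~ half e x -> half e y ->
  exists p1, edge_path setT x (d0 e) p1 /\ (size p1 < size p)%N.
Proof.
elim: p x => [x /= -> /negP //|f p IH x [_ fx py]] ex ey.
have [fe|fe] := pselect (f = e); first by exists [::]; rewrite -fe.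
have [fb|fb] := pselect (f = bar e).
  by move: ex; rewrite -fx fb d0_bar half_d1.
have [||p1 [p1e p1s]] := IH _ py; rewrite -?(half_step fe fb) ?fx //.
by exists (f :: p1).
Qed.

(** Minimality of the tree of a reduced graph. Suppose that the half-tree
    contains no point of the orbit. If the stabilizer of the end of [e] moves
    [e], it carries the other side of [e] into the half-tree. If not, [e] lies
    over a loop, and the translation along [e] brings the point of the orbit
    closest to the end of [e] still closer. *)
Lemma orbit_meets_half e x : reduced A -> exists g, half e (actV g x).
Proof.
move=> redA; apply: contrapT => no.
have {}no g : half e (actV g x) = false.
  by apply/negbTE/negP => H; apply: no; exists g.
have [z ez zi] := stabV_gen gbsT (d1 e).
rewrite -d0_bar in ez.
have zd : actV z (d0 (bar e)) = d0 (bar e).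
  by have : stabV (d0 (bar e)) z by rewrite ez; exact: cyclic_set_gen.
have [ze|ze] := pselect (actE z (bar e) = bar e); last first.
  apply: ze; apply: (half_disjoint treeT (v := actV z x)).
  - by rewrite act_d0 zd.
  - by rewrite half_act half_bar // -(actV1 x) no.
  - by rewrite half_bar // no.
have [g] := index1_translate redA zi ez ze; rewrite d1_bar d0_bar => eg.
pose P n := `[< exists k p, edge_path setT (actV k x) (d1 e) p /\ size p = n >].
have exP : exists n, P n.
  have [p [px _]] := tree_path treeT x (d1 e).
  by exists (size p); apply/asboolP; exists 1, p; rewrite actV1.
case: (ex_minnP exP) => _ /asboolP[k [p [kp <-]]] minp.
have [||p1 [p1e p1s]] := crossing_prefix kp (e := e); rewrite ?no ?half_d1 //.
have := edge_path_actT g^-1 p1e; rewrite eg actVK -actVM => kp1.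
have /minp : P (size p1).
  by apply/asboolP; exists (g^-1 * k), (map (actE g^-1) p1); rewrite size_map.
by rewrite leqNgt p1s.
Qed.

Lemma orbit_separated e x : reduced A ->
  exists g h, half e (actV g x) != half e (actV h x).
Proof.
move=> redA; have [g eg] := orbit_meets_half e x redA.
have [h] := orbit_meets_half (bar e) x redA; rewrite half_bar // => eh.
by exists g, h; rewrite eg (negbTE eh).
Qed.

(** Otherwise the elements [g] such that [e] never separates [h x] from [h g x]
    form a subgroup containing the generators, against minimality. *)
Lemma generator_separated (s : seq G) e x : reduced A ->
  (forall H, is_subgroup H -> [set` s] `<=` H -> H = setT) ->
  exists h g, g \in s /\ half e (actV h x) != half e (actV (h * g) x).
Proof.
move=> redA gen_s; apply: contrapT => no.
pose H := [set g : G | forall h, half e (actV h x) = half e (actV (h * g) x)].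
have HT : H = setT.
  apply: gen_s => [|g gs h].
    apply/is_subgroupP; split=> [h|g g' Hg Hg' h|g Hg h]; first by rewrite mulg1.
      by rewrite Hg Hg' mulgA.
    by rewrite (Hg (h * g^-1)) mulgVK.
  by apply/eqP/negPn/negP => hg; apply: no; exists h, g.
have [g [h /negP]] := orbit_separated e x redA; apply; apply/eqP.
have : H (g^-1 * h) by rewrite HT.
by move/(_ g); rewrite mulVKg.
Qed.

(** The key consequence of the hypothesis on moduli: the vertex stabilizers are
    the maximal elliptic subgroups, hence do not depend on the decomposition.
    If [stabV x] fixes [y], it fixes the first edge towards [y], which then has
    index one and, the graph being reduced, lies over a loop; the element
    carrying [x] to the next vertex has an integral modulus, so this vertex has
    the same stabilizer. *)
Lemma stabV_maximal c x y : reduced A -> no_integral_modulus c ->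
  (forall x z, stabV x = cyclic_set z -> commens z c) ->
  stabV x `<=` stabV y -> stabV x = stabV y /\ piV x = piV y.
Proof.
move=> redA cq cz; have [p [px rp]] := tree_path treeT x y.
elim: p x px rp => [x /= ->//|e p IH x px rp] xy.
have [_ ex py] := px; have [z xz zi] := stabV_gen gbsT x.
have zx : stabV x z by rewrite xz; exact: cyclic_set_gen.
have ze : actE z e = e.
  apply: (fix_separating zx (xy _ zx)).
  by have [/negbTE -> ->] := reduced_path_half (p := [::]) treeT px rp.
have [|g eg] := index1_translate redA zi _ ze; first by rewrite ex.
have d1z : stabV (d1 e) = cyclic_set (g * z * g^-1).
  by rewrite eg stabV_act ex xz conj_by_cyclic.
have [j _ zj] : cyclic_set (g * z * g^-1) z by rewrite -d1z; apply: stabE_d1.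
have [m [n [m0 n0 zc]]] := cz _ _ xz.
have j0 : j <> 0%R.
  move=> j0; rewrite j0 in zj.
  by have := @infinite_order_neq0 _ z 1%R zi; rewrite -{1}zj => /(_ erefl).
have jc : conj_power c g (n * j)%R n.
  split=> //; first exact: mulz_neq0.
  by rewrite expgzM -zc expgzC !expgzJ zj.
have j1 : `|j|%N = 1%N.
  have := cq _ _ _ (conj_powerV jc) (dvdz_mulr _ (dvdzz n)).
  rewrite abszM => /eqP; rewrite -{1}(muln1 `|n|%N) eqn_pmul2l; first by move/eqP.
  by rewrite absz_gt0; apply/eqP.
have d1x : stabV (d1 e) = stabV x.
  rewrite d1z xz; apply/seteqP; split; apply: cyclic_set_sub; try exact: cyclic_subgroup.
    exists j => //; rewrite -{1}zj -expgzM.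
    have -> : (j * j = 1)%R by nia.
    by rewrite expgz1.
  by exists j.
have -> : piV x = piV (d1 e) by rewrite eg (piV_act bsT) ex.
rewrite -d1x; apply: IH py (reduced_path_tail rp) _.
by rewrite d1x.
Qed.

(** Each edge of [A] lifts to as many edges at a lift of its origin as its index
    says. So in a tree of valence at most two, a vertex of [A] where two edges
    start has indices one there, hence only loops, and the two ends of an edge
    that is not a loop start no other edge. *)
Lemma line_quotient : reduced A ->
  (forall e1 e2 e3 : edge T, d0 e1 = d0 e2 -> d0 e1 = d0 e3 ->
    [\/ e1 = e2, e1 = e3 | e2 = e3]) ->
  (forall a, `|gi a| <= 2)%N /\ exists f : vertex A -> 'I_2, injective f.
Proof.
move=> redA val2.
have fixX (e : edge T) z (n : int) : infinite_order z -> stabV (d0 e) = cyclic_set z ->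
    actE (z ^z n) e = e -> (gi (piE e) %| n)%Z.
  move=> zi ez; have := bs_stabE bsT ez => eE ze.
  have : stabE e (z ^z n) by []. rewrite eE => -[k _].
  by rewrite -expgzM => /zi <-; apply: dvdz_mulr.
have zd (e : edge T) z (n : int) :
    stabV (d0 e) = cyclic_set z -> d0 e = d0 (actE (z ^z n) e).
  move=> ez; rewrite act_d0; apply/esym.
  by have : stabV (d0 e) (z ^z n) by rewrite ez; exists n.
split=> [a|].
  have [e ea] := piE_surj bsT a; have [z ez zi] := stabV_gen gbsT (d0 e).
  have le n : (n = 1 \/ n = 2)%N -> actE (z ^z (Posz n)) e = e -> (`|gi a| <= 2)%N.
    move=> n12 /(fixX _ _ _ zi ez); rewrite ea dvdzE => /dvdn_leq; lia.
  have [E|E|E] := val2 _ _ _ (zd e z 1%R ez) (zd e z (Posz 2) ez).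
  - by apply: (le 1%N); [left | rewrite [LHS]/= -E].
  - by apply: (le 2%N); [right | rewrite -E].
  - apply: (le 1%N); first by left.
    move/(congr1 (actE z^-1)): E; rewrite expgz1 actEK.
    by rewrite (_ : z ^z Posz 2 = z * z) // actEM actEK => /esym.
have loop (a b : edge A) : a <> b -> d0 a = d0 b -> d0 a = d1 a.
  move=> ab dab; have [e ea] := piE_surj bsT a; have [z ez zi] := stabV_gen gbsT (d0 e).
  have [|f [fe fb]] := @lift_edge (d0 e) b; first by rewrite (piV_d0 bsT) ea.
  apply: redA; apply: (cyclic_setX_gen zi).
  rewrite -ea -(bs_stabE bsT ez) /stabE /=.
  have [E|E|E] := val2 e (actE z e) f (zd e z 1%R ez) (esym fe); first by rewrite -E.
    by case: ab; rewrite -ea -fb E.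
  by case: ab; rewrite -ea -fb -E (piE_act bsT).
have [[v0] conn] := zg_connected A.
have [u hu] : exists u, forall w : vertex A, w = v0 \/ w = u.
  have [[a [av0 a1]]|no] := pselect (exists a, d0 a = v0 /\ d1 a <> v0); last first.
    exists v0 => w; left; have [p pw] := conn v0 w.
    elim: p (v0) pw {conn} no => [x /= ->//|b p IH x [_ bx pw] no].
    have bx1 : d1 b = x by apply: contrapT => b1; apply: no; exists b.
    by rewrite -bx1; apply: IH => //; rewrite bx1.
  exists (d1 a) => w; have [p pw] := conn v0 w.
  suff H p' (x : vertex A) : x = v0 \/ x = d1 a -> edge_path setT x w p' -> w = v0 \/ w = d1 a.
    by apply: H pw; left.
  elim: p' x => [x xva /= <- //|b p' IH x xva [_ bx pw']]; apply: IH pw'.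
  case: xva => xE.
    have [->|ba] := pselect (b = a); first by right.
    have := @loop a b (fun E => ba (esym E)); rewrite av0 bx xE => /(_ erefl).
    by move=> E; case: a1.
  have [->|ba] := pselect (b = bar a); first by left; rewrite d1_bar.
  have := @loop (bar a) b (fun E => ba (esym E)); rewrite d0_bar d1_bar av0 bx xE.
  by move=> /(_ erefl).
exists (fun v => if `[< v = v0 >] then ord0 else ord_max) => v w.
case: asboolP => [->|vv0]; case: asboolP => [->|wv0] // _.
by have [//|->] := hu v; have [//|->] := hu w.
Qed.

End BassSerre.

(** * Normal forms in the fundamental group *)

Section NormalForms.
Variables (A : Zgraph) (S : set (edge A)).
Hypothesis treeS : spanning_tree S.
Implicit Types (u v w : vertex A) (e f : edge A) (p q : seq (edge A)).
Implicit Types (s : seq (int * edge A)) (k l n r : int).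

(** The state [([:: (r1, e1); ...; (rm, em)], n)] stands for the element
    [a^r1 e1 ... a^rm em a^n] of the path groupoid of the graph of groups, with
    [a] denoting the generator of each vertex group met in turn. *)
Definition state : Type := (seq (int * edge A) * int)%type.
Implicit Types x y : state.

(** In normal form the exponents are remainders modulo the index of the edge
    that follows, and there is no backtracking. *)
Fixpoint normal v s : Prop :=
  if s is (r, e) :: s' then
    [/\ d0 e = v, (r %% gi e)%Z = r, forall s'', s' <> (0%R, bar e) :: s'' & normal (d1 e) s']
  else True.

(** Multiplication by [a^k]: the quotient by the index is carried across the
    edge. *)
Fixpoint shift_seq k s n : state :=
  if s is (r, e) :: s' then
    let x := shift_seq (((r + k)%R %/ gi e)%Z * gi (bar e))%R s' n in
    ((((r + k)%R %% gi e)%Z, e) :: x.1, x.2)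
  else ([::], (n + k)%R).

Definition shift k x : state := shift_seq k x.1 x.2.

(** Multiplication by [e], cancelling a following [a^0 (bar e)]. *)
Definition step e x : state :=
  if `[< exists s, x.1 = (0%R, bar e) :: s >] then (behead x.1, x.2)
  else ((0%R, e) :: x.1, x.2).

Lemma step_cancel e s n : step e ((0%R, bar e) :: s, n) = (s, n).
Proof. by rewrite /step; case: asboolP => // -[]; exists s. Qed.

Lemma step_bar_cancel e s n : step (bar e) ((0%R, e) :: s, n) = (s, n).
Proof. by rewrite -{2}[e]barK step_cancel. Qed.

Lemma step_push e x : (forall s, x.1 <> (0%R, bar e) :: s) ->
  step e x = ((0%R, e) :: x.1, x.2).
Proof. by move=> H; rewrite /step; case: asboolP => // -[s /H]. Qed.

Lemma gi_eqF e : (gi e == 0%R) = false.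
Proof. by apply/eqP/gi_neq0. Qed.

Lemma shift_normal v k x : normal v x.1 -> normal v (shift k x).1.
Proof.
case: x => s n; rewrite /shift /=.
elim: s v k => //= -[r e] s IH v k [ev re es ns]; split=> //.
- by rewrite modz_mod.
- case: s {IH} es ns => [|[r' e'] s] es [] // _ re' _ _ s'' /= [r'0 e'E _].
  apply: (es s); congr ((_, _) :: _) => //.
  by move: r'0; rewrite addrC e'E modzMDl -e'E re'.
- exact: IH.
Qed.

Lemma shift0 v x : normal v x.1 -> shift 0%R x = x.
Proof.
case: x => s n; rewrite /shift /=.
elim: s v => [|[r e] s IH] v /=; first by rewrite addr0.
case=> _ re _ ns; have -> : ((r + 0)%R %/ gi e)%Z = 0%R.
  apply/eqP; rewrite addr0 -(mulIr_eq0 _ (mulIf (negbT (gi_eqF e)))).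
  by apply/eqP/(addIr (r %% gi e)%Z); rewrite -divz_eq add0r re.
by rewrite mul0r (IH _ ns) /= addr0 re.
Qed.

Lemma shiftD k l x : shift k (shift l x) = shift (k + l)%R x.
Proof.
case: x => s n; rewrite /shift /=.
elim: s k l => [|[r e] s IH] k l /=; first by rewrite -addrA (addrC l).
have E : (r + (k + l) = ((r + l)%R %/ gi e)%Z * gi e + (((r + l)%R %% gi e)%Z + k))%R.
  by rewrite [RHS]addrA -divz_eq -addrA (addrC l).
by rewrite IH E divzMDl ?modzMDl ?gi_eqF // mulrDl (addrC (_ * _)%R).
Qed.

Lemma step_normal e x : normal (d1 e) x.1 -> normal (d0 e) (step e x).1.
Proof.
rewrite /step; case: asboolP => [[s ->] /= [_ _ _]|H] /=; first by rewrite d1_bar.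
move=> nx; split=> //; first by rewrite mod0z.
by move=> s xs; apply: H; exists s.
Qed.

Lemma step_bar e x : normal (d0 e) x.1 -> step e (step (bar e) x) = x.
Proof.
case: x => s n nx; have [[s' sE]|H] := pselect (exists s', s = (0%R, e) :: s').
  rewrite sE /= in nx *; have [_ _ H _] := nx.
  by rewrite step_bar_cancel step_push.
rewrite (@step_push (bar e)) /=; last by move=> s'; rewrite barK => E; apply: H; exists s'.
by rewrite step_cancel.
Qed.

(** The relation attached to [e]; the two cases of [step] correspond to [x]
    starting or not with [a^0 e]. *)
Lemma step_shift e x : normal (d0 e) x.1 ->
  step e (shift (gi (bar e)) (step (bar e) x)) = shift (gi e) x.
Proof.
case: x => s n nx; have [[s' sE]|H] := pselect (exists s', s = (0%R, e) :: s').
  rewrite sE /= in nx *; have [_ _ H ns'] := nx.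
  rewrite step_bar_cancel step_push.
    by rewrite /shift /= add0r divzz gi_eqF modzz mul1r.
  have := @shift_normal (d0 e) (gi e) ((0%R, e) :: s', n) nx.
  by rewrite /= add0r divzz gi_eqF mul1r => -[].
rewrite (@step_push (bar e)) /=; last by move=> s'; rewrite barK => E; apply: H; exists s'.
rewrite /shift /= add0r divzz gi_eqF modzz mul1r barK.
by rewrite step_cancel -surjective_pairing.
Qed.

Definition step_path p x : state := foldr step x p.

Lemma step_path_cat p q x : step_path (p ++ q) x = step_path p (step_path q x).
Proof. by rewrite /step_path foldr_cat. Qed.

Lemma step_path_normal S' u w p x : edge_path S' u w p ->
  normal w x.1 -> normal u (step_path p x).1.
Proof.
elim: p u => [u -> //|e p IH u [_ <- pw] nx] /=.
exact/step_normal/IH.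
Qed.

Lemma step_path_rev S' u w p x : edge_path S' u w p -> normal u x.1 ->
  step_path p (step_path (rev_path p) x) = x.
Proof.
elim: p u x => // e p IH u x [_ eu pw] nx.
rewrite /rev_path /= rev_cons -cats1 step_path_cat (IH _ _ pw); last first.
  by rewrite -d0_bar; apply: step_normal; rewrite d1_bar eu.
by rewrite step_bar ?eu.
Qed.

(** A loop in a tree becomes empty when backtracks are cancelled. *)
Lemma step_path_loop u p x : edge_path S u u p -> normal u x.1 -> step_path p x = x.
Proof.
have [n] := ubnP (size p); elim: n p => // n IH p; rewrite ltnS => pn pu nx.
have [rp|nrp] := pselect (reduced_path p).
  by case: treeS => _ _ /(_ u p pu rp) ->.
have [p1 [e [p2 E]]] : exists p1 e p2, p = p1 ++ [:: e, bar e & p2].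
  by apply: contrapT => H; apply: nrp => p1 e p2 E; apply: H; exists p1, e, p2.
move: pu pn; rewrite E => /edge_path_split[v [p1v [Se ev [_ _ p2u]]]].
rewrite d1_bar ev in p2u; rewrite size_cat /= => pn.
rewrite step_path_cat /= step_bar; last by rewrite ev; apply: step_path_normal p2u nx.
rewrite -step_path_cat; apply: IH nx; first by rewrite size_cat; lia.
exact: edge_path_cat p1v p2u.
Qed.

Variables (v0 : vertex A) (gam : vertex A -> seq (edge A)).
Hypothesis gamP : forall v, edge_path S v0 v (gam v).
Notation normal0 x := (normal v0 (fst x)).

Definition transport v x := step_path (gam v) x.
Definition transport_inv v x := step_path (rev_path (gam v)) x.

Lemma transport_normal v x : normal v x.1 -> normal0 (transport v x).
Proof. exact: step_path_normal (gamP v). Qed.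

Lemma rev_gamP v : edge_path S v v0 (rev_path (gam v)).
Proof. by apply: edge_path_rev (gamP v); case: treeS. Qed.

Lemma transport_inv_normal v x : normal0 x -> normal v (transport_inv v x).1.
Proof. exact: step_path_normal (rev_gamP v). Qed.

Lemma transportK v x : normal v x.1 -> transport_inv v (transport v x) = x.
Proof.
move=> nx; rewrite /transport_inv /transport -{2}(rev_pathK (gam v)).
exact: step_path_rev (rev_gamP v) nx.
Qed.

Lemma transport_invK v x : normal0 x -> transport v (transport_inv v x) = x.
Proof. exact: step_path_rev (gamP v). Qed.

(** Conjugating by the paths of the tree [S] from a base vertex, the path
    groupoid gives an action of the fundamental group on normal forms. *)
Definition act_letter (a : pi1_gen A * bool) x : state :=
  match a with
  | (inl v, b) => transport v (shift (if b then 1 else -1)%R (transport_inv v x))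
  | (inr e, true) => transport (d0 e) (step e (transport_inv (d1 e) x))
  | (inr e, false) => transport (d1 e) (step (bar e) (transport_inv (d0 e) x))
  end.

Definition act_word (u : word (pi1_gen A)) x : state :=
  foldr act_letter x (u : seq (pi1_gen A * bool)).

Lemma act_word_cat (u u' : word (pi1_gen A)) x :
  act_word (u ++ u') x = act_word u (act_word u' x).
Proof. exact: foldr_cat. Qed.

Lemma step_bar_normal e x : normal (d0 e) x.1 -> normal (d1 e) (step (bar e) x).1.
Proof. by rewrite -d0_bar -{1}d1_bar => /step_normal. Qed.

Lemma act_letter_normal a x : normal0 x -> normal0 (act_letter a x).
Proof.
move=> nx; case: a => [[v|e] b]; last case: b; apply: transport_normal.
- exact/shift_normal/transport_inv_normal.
- exact/step_normal/transport_inv_normal.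
- exact/step_bar_normal/transport_inv_normal.
Qed.

Lemma act_word_normal (u : word (pi1_gen A)) x : normal0 x -> normal0 (act_word u x).
Proof. by move=> nx; elim: u => //= a u IH; apply: act_letter_normal. Qed.

Lemma act_letterK a b x : normal0 x -> act_letter (a, b) (act_letter (a, ~~ b) x) = x.
Proof.
move=> nx; case: a => [v|e] /=.
  have nv := transport_inv_normal v nx.
  rewrite transportK ?shiftD; last exact: shift_normal.
  have -> : ((if b then 1 else -1) + (if ~~ b then 1 else -1) = 0 :> int)%R by case: b.
  by rewrite (shift0 nv) transport_invK.
have n0 := transport_inv_normal (d0 e) nx; have n1 := transport_inv_normal (d1 e) nx.
case: b => /=; rewrite transportK.
- by rewrite step_bar // transport_invK.
- exact: step_bar_normal.
- have := @step_bar (bar e); rewrite d0_bar barK => /(_ _ n1) ->.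
  by rewrite transport_invK.
- exact: step_normal.
Qed.

Lemma act_vertex_power v n x : normal0 x ->
  act_word (wpow (inl v) n) x = transport v (shift n (transport_inv v x)).
Proof.
move=> nx; have nv := transport_inv_normal v nx.
have aux b (k : nat) : act_word (nseq k (inl v, b)) x
    = transport v (shift (if b then Posz k else - Posz k)%R (transport_inv v x)).
  elim: k => [|k IH].
    by rewrite [LHS]/= (_ : (if b then _ else _) = 0%R) ?(shift0 nv) ?transport_invK //; case: b.
  rewrite -[LHS]/(act_letter (inl v, b) (act_word (nseq k (inl v, b)) x)) IH /=.
  rewrite transportK; last exact: shift_normal.
  by rewrite shiftD; congr (transport v (shift _ _)); case: (b); lia.
by case: n => n; [exact: (aux true) | rewrite NegzE; exact: (aux false n.+1)].
Qed.

Lemma act_word_eq (u u' : word (pi1_gen A)) : word_eq (pi1_rel S) u u' ->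
  forall x, normal0 x -> act_word u x = act_word u' x.
Proof.
elim=> {u u'} [//|u u' _ IH x nx|u u' u'' _ IH _ IH' x nx|u u' w w' _ IH _ IH' x nx
  |a b x nx|u u' [e|e|e Se] x nx].
- by rewrite IH.
- by rewrite IH ?IH'.
- by rewrite !act_word_cat IH' // IH //; apply: act_word_normal.
- exact: act_letterK.
- by rewrite /= d0_bar d1_bar.
- rewrite !act_word_cat act_vertex_power; last exact: act_letter_normal.
  rewrite act_vertex_power //= transportK; last first.
    exact/shift_normal/transport_inv_normal/transport_normal/step_bar_normal/transport_inv_normal.
  rewrite transportK; last exact/step_bar_normal/transport_inv_normal.
  by rewrite step_shift //; apply: transport_inv_normal.
- rewrite /= -[RHS](@step_path_loop v0 (gam (d0 e) ++ e :: rev_path (gam (d1 e)))) //.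
    by rewrite step_path_cat.
  by apply: edge_path_cat (gamP _) _; split=> //; apply: rev_gamP.
Qed.

Fixpoint path_word v s k : word (pi1_gen A) :=
  if s is (r, e) :: s' then wpow (inl v) r ++ wpow (inr e) 1%R ++ path_word (d1 e) s' k
  else wpow (inl v) k.

Fixpoint is_path v w s : Prop :=
  if s is (r, e) :: s' then d0 e = v /\ is_path (d1 e) w s' else v = w.

Fixpoint reduced_word s : Prop :=
  if s is (r, e) :: s' then
    (forall r' s'', s' = (r', bar e) :: s'' -> ~ (gi (bar e) %| r')%Z) /\ reduced_word s'
  else True.

Fixpoint path_state s k : state :=
  if s is (r, e) :: s' then shift r (step e (path_state s' k)) else ([::], k).

Lemma path_state_normal v w s k : is_path v w s -> normal v (path_state s k).1.
Proof.
elim: s v => [//|[r e] s IH] v /= [<- /IH ns].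
exact/shift_normal/step_normal.
Qed.

(** Evaluated from the right, a reduced word never meets a cancellation. *)
Lemma path_state_reduced v w s k : is_path v w s -> reduced_word s ->
  size (path_state s k).1 = size s /\
  forall r e s', s = (r, e) :: s' -> exists s'', (path_state s k).1 = ((r %% gi e)%Z, e) :: s''.
Proof.
elim: s v => [//|[r e] s IH] v [ev sw] [red rs].
have [szs hd] := IH _ sw rs.
have sizeP l t n : size (shift_seq l t n).1 = size t.
  by elim: t l => //= -[r' e'] t IHt l /=; rewrite IHt.
have E : step e (path_state s k) = ((0%R, e) :: (path_state s k).1, (path_state s k).2).
  apply: step_push => t tE; case: s hd red {IH sw rs szs} tE => [//|[r' e'] s] hd red tE.
  have [t' tE'] := hd _ _ _ erefl; move: tE; rewrite tE' => -[r'0 e'E _].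
  by apply: (red r' s); [rewrite e'E | apply/dvdz_mod0P; rewrite -e'E].
rewrite [path_state _ _]/= E; split; first by rewrite sizeP /= szs.
by move=> r1 e1 s1 [<- <- _]; rewrite /shift /= add0r; eexists.
Qed.

Lemma act_path_word v w s k : is_path v w s ->
  act_word (path_word v s k) (transport w ([::], 0%R)) = transport v (path_state s k).
Proof.
elim: s v => [v <-|[r e] s IH v [ev sw]].
  rewrite act_vertex_power; last exact: transport_normal.
  by rewrite transportK //= /shift /= add0r.
rewrite -[path_word v _ k]/(wpow (inl v) r ++ (wpow (inr e) 1%R ++ path_word (d1 e) s k)).
rewrite !act_word_cat (IH _ sw).
have ns := path_state_normal k sw.
rewrite act_vertex_power; last exact/act_word_normal/transport_normal.
rewrite /= (transportK ns) -ev transportK //; exact: step_normal.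
Qed.

(** The normal form theorem: an element equal to 1 fixes the empty state. *)
Lemma reduced_word_neq1 v s k : is_path v v s -> reduced_word s ->
  word_eq (pi1_rel S) (path_word v s k) [::] -> s = [::] /\ k = 0%R.
Proof.
move=> sv rs /act_word_eq/(_ (transport v ([::], 0%R))).
rewrite act_path_word // => /(_ (@transport_normal v ([::], 0%R) I)).
move/(congr1 (transport_inv v)); rewrite !transportK //; last exact: path_state_normal sv.
move=> E; have [] := path_state_reduced k sv rs; rewrite E /= => /esym/size0nil s0 _.
by move: E; rewrite s0 => -[].
Qed.

End NormalForms.

Section FundamentalGroupElements.
Variable A : Zgraph.
Implicit Types (u v w : vertex A) (e : edge A) (s : seq (int * edge A)) (k : int).
Local Open Scope group_scope.

Section Evaluation.
Variables (G : groupType) (a : vertex A -> G) (t : edge A -> G).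

Fixpoint path_prod v s k : G :=
  if s is (r, e) :: s' then a v ^z r * (t e * path_prod (d1 e) s' k) else a v ^z k.

(** A generator [a v] of each vertex group and stable letters [t e], satisfying
    the properties through which the fundamental group is used: the relations,
    the normal form theorem, and the freedom in the choice of the images of the
    stable letters under homomorphisms to an abelian group. *)
Record fundamental_system (S : set (edge A)) : Prop := FundamentalSystem {
  fs_bar : forall e, t (bar e) = (t e)^-1;
  fs_edge : forall e, t e * a (d1 e) ^z gi (bar e) * (t e)^-1 = a (d0 e) ^z gi e;
  fs_tree : forall e, S e -> t e = 1;
  fs_gen : forall H, subgroup H -> (forall v, H (a v)) -> (forall e, H (t e)) ->
    forall g, H g;
  fs_reduced : forall v s k, is_path v v s -> reduced_word s ->
    path_prod v s k = 1 -> s = [::] /\ k = 0%R;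
  fs_hom : forall c : edge A -> 'I_3, (forall e, c (bar e) = - c e)%R ->
    (forall e, S e -> c e = 0%R) ->
    exists chi : G -> 'I_3, (forall g h, chi (g * h)%g = chi g + chi h)%R /\
      forall e, chi (t e) = c e }.

End Evaluation.

Variables (S : set (edge A)) (G : groupType).
Hypothesis treeS : spanning_tree S.
Variable f : {multiplicative (pi1 S) -> G}.
Hypothesis f_bij : bijective f.

Definition eval_word (u : word (pi1_gen A)) : G :=
  f (presented_class (pi1_rel S) u).

Lemma eval_word_cat (u u' : word (pi1_gen A)) :
  eval_word (u ++ u') = eval_word u * eval_word u'.
Proof.
rewrite /eval_word -gmulfM; congr (f _).
exact/esym/(presented_mulE (pi1_rel S)).
Qed.

Lemma eval_word_eq (u u' : word (pi1_gen A)) :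
  eval_word u = eval_word u' <-> word_eq (pi1_rel S) u u'.
Proof.
split=> [|uu']; last by congr (f _); apply/presented_classE.
by move/(bij_inj f_bij)/presented_classE.
Qed.

Lemma eval_word_nil : eval_word [::] = 1.
Proof.
apply: (mulgI (eval_word [::])).
by rewrite -eval_word_cat mulg1.
Qed.

Lemma eval_word_surj g : exists u : word (pi1_gen A), eval_word u = g.
Proof.
have [f' fK f'K] := f_bij; exists (repr (f' g)).
by rewrite /eval_word presented_repr f'K.
Qed.

Lemma eval_wpow (x : pi1_gen A) k : eval_word (wpow x k) = eval_word (wpow x 1%R) ^z k.
Proof.
have inv : eval_word [:: (x, false)] = (eval_word [:: (x, true)])^-1.
  apply: (mulgI (eval_word [:: (x, true)])); rewrite mulgV -eval_word_cat -eval_word_nil.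
  exact/eval_word_eq/(word_cancel _ x true).
have aux b (n : nat) : eval_word (nseq n (x, b)) = eval_word [:: (x, b)] ^+ n.
  elim: n => [|n IH]; first exact: eval_word_nil.
  by rewrite expgS -IH -eval_word_cat.
case: k => n; first exact: (aux true).
by rewrite [wpow _ _]/= (aux false n.+1) inv expVgn.
Qed.

Definition vertex_gen v : G := eval_word (wpow (inl v) 1%R).
Definition stable_letter e : G := eval_word (wpow (inr e) 1%R).

Lemma eval_path_word v s k :
  eval_word (path_word v s k) = path_prod vertex_gen stable_letter v s k.
Proof.
elim: s v => [|[r e] s IH] v; first exact: eval_wpow.
rewrite -[path_word v _ k]/(wpow (inl v) r ++ (wpow (inr e) 1%R ++ path_word (d1 e) s k)).
by rewrite !eval_word_cat IH eval_wpow.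
Qed.

Definition letter_sum (c : edge A -> 'I_3) (x : pi1_gen A * bool) : 'I_3 :=
  match x with (inl _, _) => 0 | (inr e, true) => c e | (inr e, false) => - c e end%R.

Lemma word_sum_eq (c : edge A -> 'I_3) (u u' : word (pi1_gen A)) :
  (forall e, c (bar e) = - c e)%R -> (forall e, S e -> c e = 0%R) ->
  word_eq (pi1_rel S) u u' ->
  (\sum_(x <- (u : seq _)) letter_sum c x = \sum_(x <- (u' : seq _)) letter_sum c x)%R.
Proof.
move=> cbar cS; have pow0 v k : (\sum_(x <- (wpow (inl v) k : seq _)) letter_sum c x = 0)%R.
  have aux b n : (\sum_(x <- nseq n (inl v : pi1_gen A, b)) letter_sum c x = 0)%R.
    by elim: n => [|n IH]; rewrite /= ?big_nil // big_cons IH addr0.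
  by case: k => n; [exact: (aux true) | exact: (aux false n.+1)].
elim=> {u u'} [//|u u' _ -> //|u u' u'' _ -> //|u u' w w' _ E _ E'|x b|u u' [e|e|e Se]].
- by rewrite !big_cat E E'.
- by case: x => [v|e]; case: b; rewrite !big_cons !big_nil /= ?addr0 ?subrr ?addNr.
- by rewrite !big_cons !big_nil /= cbar.
- by rewrite !big_cat /= !pow0 !big_cons !big_nil /= !addr0 add0r subrr.
- by rewrite !big_cons !big_nil /= cS ?addr0.
Qed.

Lemma pi1_fundamental_system : fundamental_system vertex_gen stable_letter S.
Proof.
split.
- move=> e; rewrite -[RHS](expgzN _ 1%R) -[RHS]eval_wpow.
  exact/eval_word_eq/word_rel/pi1_rel_bar.
- move=> e; rewrite -(expgzN _ 1%R) -!eval_wpow -!eval_word_cat -catA.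
  exact/eval_word_eq/word_rel/pi1_rel_edge.
- move=> e Se; rewrite -eval_word_nil.
  exact/eval_word_eq/word_rel/pi1_rel_tree.
- move=> H sH Ha Ht g; have [u <-] := eval_word_surj g.
  elim: u => [|[x b] u IH]; first by rewrite eval_word_nil; apply: subgroup1.
  rewrite -cat1s (eval_word_cat [:: _]); apply: subgroupM => //.
  have Hx : H (eval_word (wpow x 1%R)) by case: x => x; [exact: Ha | exact: Ht].
  case: b => //; have := subgroupV sH Hx.
  by rewrite -(expgzN _ 1%R) -eval_wpow.
- have [_ [[v0] conn] _] := treeS; have [gam gamP] := choice (conn v0).
  move=> v s k sv rs; rewrite -eval_path_word -eval_word_nil => /eval_word_eq.
  exact: (reduced_word_neq1 treeS gamP sv rs).
- move=> c cbar cS; have [f' fK f'K] := f_bij.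
  pose chi g := (\sum_(x <- (repr (f' g) : seq _)) letter_sum c x)%R.
  have chiE (u : word (pi1_gen A)) :
      chi (eval_word u) = (\sum_(x <- (u : seq _)) letter_sum c x)%R.
    by apply: word_sum_eq => //; rewrite /eval_word fK; apply: repr_class.
  exists chi; split=> [g h|e].
    have [u <-] := eval_word_surj g; have [u' <-] := eval_word_surj h.
    by rewrite -eval_word_cat !chiE big_cat.
  by rewrite chiE !big_cons !big_nil /= addr0.
Qed.

End FundamentalGroupElements.

Lemma has_fundamental_system (A : Zgraph) (G : groupType) : has_fundamental_group A G ->
  exists (S : set (edge A)) (a : vertex A -> G) (t : edge A -> G),
    spanning_tree S /\ fundamental_system a t S.
Proof.
case=> S treeS [f f_bij]; exists S, (vertex_gen f), (stable_letter f).
by split=> //; apply: pi1_fundamental_system.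
Qed.

(** * The Bass-Serre tree *)

Lemma sval_inj T (P : T -> Prop) : injective (@proj1_sig T P).
Proof. by case=> [x px] [y py] /= xy; apply: eq_exist. Qed.

Section CosetTree.
Variables (A : Zgraph) (G : groupType) (a : vertex A -> G) (t : edge A -> G).
Variable S : set (edge A).
Hypothesis treeS : spanning_tree S.
Hypothesis fsS : fundamental_system a t S.
Implicit Types (v w : vertex A) (e : edge A) (g h : G) (k n r : int).
Local Open Scope group_scope.

Definition vgroup v : set G := cyclic_set (a v).
Definition egroup e : set G := cyclic_set (a (d0 e) ^z gi e).
Definition lcoset_of g (H : set G) : set G := [set g * h | h in H].

(** A vertex over [v] is a coset of the vertex group, an edge over [e] a coset
    of the edge group; cosets are kept as sets, so that equality is that of
    cosets, and a representative is chosen to define the incidence maps. *)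
Definition vcoset : Type :=
  {x : vertex A * set G | exists g, x.2 = lcoset_of g (vgroup x.1)}.
Definition ecoset : Type :=
  {x : edge A * set G | exists g, x.2 = lcoset_of g (egroup x.1)}.

Definition mkV v g : vcoset :=
  exist (fun x : vertex A * set G => exists g, x.2 = lcoset_of g (vgroup x.1))
    (v, lcoset_of g (vgroup v)) (ex_intro _ g erefl).
Definition mkE e g : ecoset :=
  exist (fun x : edge A * set G => exists g, x.2 = lcoset_of g (egroup x.1))
    (e, lcoset_of g (egroup e)) (ex_intro _ g erefl).

Lemma mkV_eq v g g' : vgroup v (g^-1 * g') -> mkV v g = mkV v g'.
Proof.
move=> H; apply: eq_exist; congr (_, _).
by apply/lcoset_eq => //; apply: cyclic_subgroup.
Qed.

Lemma mkE_eq e g g' : egroup e (g^-1 * g') -> mkE e g = mkE e g'.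
Proof.
move=> H; apply: eq_exist; congr (_, _).
by apply/lcoset_eq => //; apply: cyclic_subgroup.
Qed.

Lemma mkV_inj v g v' g' : mkV v g = mkV v' g' -> v = v' /\ vgroup v (g^-1 * g').
Proof.
move=> /(congr1 sval) [<- H]; split=> //.
by apply/lcoset_eq => //; apply: cyclic_subgroup.
Qed.

Lemma mkE_inj e g e' g' : mkE e g = mkE e' g' -> e = e' /\ egroup e (g^-1 * g').
Proof.
move=> /(congr1 sval) [<- H]; split=> //.
by apply/lcoset_eq => //; apply: cyclic_subgroup.
Qed.

Definition repV (x : vcoset) : G := projT1 (cid (svalP x)).
Definition repE (x : ecoset) : G := projT1 (cid (svalP x)).

Lemma repVK x : x = mkV (sval x).1 (repV x).
Proof. by apply: sval_inj; rewrite /= -(projT2 (cid (svalP x))) -surjective_pairing. Qed.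

Lemma repEK x : x = mkE (sval x).1 (repE x).
Proof. by apply: sval_inj; rewrite /= -(projT2 (cid (svalP x))) -surjective_pairing. Qed.

Lemma repV_mk v g : vgroup v ((repV (mkV v g))^-1 * g).
Proof. by have [] := mkV_inj (esym (repVK (mkV v g))). Qed.

Lemma repE_mk e g : egroup e ((repE (mkE e g))^-1 * g).
Proof. by have [] := mkE_inj (esym (repEK (mkE e g))). Qed.

Definition d0C (x : ecoset) : vcoset := mkV (d0 (sval x).1) (repE x).
Definition barC (x : ecoset) : ecoset :=
  mkE (bar (sval x).1) (repE x * t (sval x).1).
Definition d1C (x : ecoset) : vcoset := d0C (barC x).
Definition actVC g (x : vcoset) : vcoset := mkV (sval x).1 (g * repV x).
Definition actEC g (x : ecoset) : ecoset := mkE (sval x).1 (g * repE x).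

Lemma egroup_sub e : egroup e `<=` vgroup (d0 e).
Proof. by apply: cyclic_set_sub; [exact: cyclic_subgroup | exists (gi e)]. Qed.

Lemma egroup_bar e x : egroup e x -> egroup (bar e) ((t e)^-1 * x * t e).
Proof.
case=> n _ <-; rewrite /egroup -{2}[t e]invgK expgzJ -(fs_edge fsS e) d0_bar.
by rewrite invgK !mulgA mulVg mul1g mulgVK; exists n.
Qed.

Lemma d0C_mk e g : d0C (mkE e g) = mkV (d0 e) g.
Proof. exact/mkV_eq/egroup_sub/repE_mk. Qed.

Lemma barC_mk e g : barC (mkE e g) = mkE (bar e) (g * t e).
Proof.
apply: mkE_eq; have /egroup_bar := repE_mk e g.
by rewrite invgM !mulgA.
Qed.

Lemma d1C_mk e g : d1C (mkE e g) = mkV (d1 e) (g * t e).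
Proof. by rewrite /d1C barC_mk d0C_mk d0_bar. Qed.

Lemma actVC_mk g v h : actVC g (mkV v h) = mkV v (g * h).
Proof. by apply: mkV_eq; rewrite invgM -mulgA mulKg; apply: repV_mk. Qed.

Lemma actEC_mk g e h : actEC g (mkE e h) = mkE e (g * h).
Proof. by apply: mkE_eq; rewrite invgM -mulgA mulKg; apply: repE_mk. Qed.

Lemma barCK : involutive barC.
Proof.
by move=> x; rewrite (repEK x) !barC_mk barK (fs_bar fsS) mulgK.
Qed.

Lemma barC_neq x : barC x <> x.
Proof. by rewrite (repEK x) barC_mk => /mkE_inj[/bar_neq]. Qed.

Definition coset_graph : graph :=
  @Graph vcoset ecoset d0C d1C barC barCK barC_neq (fun=> erefl).

Notation vC := (vertex coset_graph).
Notation eC := (edge coset_graph).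

Lemma coset_connected : connected_by (@setT eC).
Proof.
have [_ [[v0] connS] _] := treeS.
split; first by apply: inhabits; exact: mkV v0 1.
pose conn (x y : vC) := exists p, edge_path setT x y p.
have conn_trans x y z : conn x y -> conn y z -> conn x z.
  by move=> [p xy] [q yz]; exists (p ++ q); apply: edge_path_cat xy yz.
have conn_sym x y : conn x y -> conn y x.
  by move=> [p xy]; exists (rev_path p); apply: edge_path_revT.
have conn_edge e g : conn (mkV (d0 e) g) (mkV (d1 e) (g * t e)).
  exists [:: mkE e g : eC] => /=; split=> //; first exact: d0C_mk.
  exact: d1C_mk.
have conn_tree v w g : conn (mkV v g) (mkV w g).
  have [p] := connS v w; elim: p v => [v /= <-|e p IH v [Se <- pw]]; first by exists [::].
  apply: conn_trans (IH _ pw); have := conn_edge e g.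
  by rewrite (fs_tree fsS Se) mulg1.
suff H g : forall v h, conn (mkV v h) (mkV v (h * g)).
  move=> x y; rewrite (repVK x) (repVK y).
  apply: conn_trans (conn_tree _ (sval y).1 _) _.
  by have := H ((repV x)^-1 * repV y) (sval y).1 (repV x); rewrite mulVKg.
apply: (fs_gen fsS (H := [set g | forall v h, conn (mkV v h) (mkV v (h * g))])) g.
- split=> [v h|g g' Hg Hg' v h|g Hg v h]; first by rewrite mulg1; exists [::].
    by apply: conn_trans (Hg v h) _; rewrite mulgA.
  by apply: conn_sym; have := Hg v (h * g^-1); rewrite mulgVK.
- move=> w v h; apply: (conn_trans _ _ _ (conn_tree v w h)).
  apply: (conn_trans _ _ _ _ (conn_tree w v _)); exists [::] => /=.
  by apply: mkV_eq; rewrite mulKg; apply: cyclic_set_gen.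
- move=> e v h; apply: (conn_trans _ _ _ (conn_tree v (d0 e) h)).
  exact: (conn_trans _ _ _ (conn_edge e h) (conn_tree _ _ _)).
Qed.

(** A path reads off a word leading from [g] to [g'], and a backtrack of the
    word is one of the path: if [gi (bar e)] divides the exponent before
    [bar e], then that power lies in the edge group, and the coset is that of
    the previous edge reversed. *)
Lemma coset_path_word (p : seq eC) v g w g' :
  edge_path setT (mkV v g : vC) (mkV w g' : vC) p -> reduced_path p ->
  exists s k, [/\ is_path v w s, g * path_prod a t v s k = g', reduced_word s,
    size s = size p &
    forall E p', p = E :: p' -> exists r e s', s = (r, e) :: s' /\ E = mkE e (g * a v ^z r)].
Proof.
elim: p v g => [|E p IH] v g.
  move=> /mkV_inj[<- [k _ gk]] _; exists [::], k; split=> //.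
  by rewrite /= gk mulVKg.
case=> _ d0E pw rp; move: (repEK E) d0E pw => EE.
set e := (sval E).1 in EE; set h := repE E in EE.
rewrite EE => /=; rewrite d0C_mk d1C_mk => /esym/mkV_inj[ev [r _ hr]].
have {hr} hE : h = g * a v ^z r by rewrite hr mulVKg.
move=> pw; have [s [k [sw sk rs sz hd]]] := IH _ _ pw (reduced_path_tail rp).
exists ((r, e) :: s), k; split=> //=.
- by rewrite -sk hE !mulgA.
- split=> // r' s' sE /dvdzP[n nr].
  case: p sz hd rp {IH pw} => [|E' p] sz hd rp; first by rewrite sE in sz.
  have [r1 [e1 [s1 [sE1 EE1]]]] := hd _ _ erefl.
  move: sE1; rewrite sE => -[r'E e'E _]; apply: (rp [::] E p) => /=.
  congr [:: _, _ & _]; rewrite EE1 EE [RHS]barC_mk -e'E; apply/esym/mkE_eq.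
  rewrite mulKg -r'E nr /egroup d0_bar mulrC expgzM.
  by exists n.
- by rewrite sz.
- by move=> E1 p1 [<- _]; exists r, e, s; rewrite -hE.
Qed.

Lemma coset_tree : is_tree coset_graph.
Proof.
split=> //; first exact: coset_connected.
move=> x p; rewrite (repVK x) => px rp.
have [s [k [sw sk rs sz _]]] := coset_path_word px rp.
have [s0 _] : s = [::] /\ k = 0%R.
  apply: (fs_reduced fsS sw rs); apply: (mulgI (repV x)).
  by rewrite sk mulg1.
by apply/size0nil; rewrite -sz s0.
Qed.

Lemma actVC1 x : actVC 1 x = x.
Proof. by rewrite {2}(repVK x) /actVC mul1g. Qed.
Lemma actEC1 x : actEC 1 x = x.
Proof. by rewrite {2}(repEK x) /actEC mul1g. Qed.
Lemma actVCM g h x : actVC (g * h) x = actVC g (actVC h x).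
Proof. by rewrite (repVK x) !actVC_mk mulgA. Qed.
Lemma actECM g h x : actEC (g * h) x = actEC g (actEC h x).
Proof. by rewrite (repEK x) !actEC_mk mulgA. Qed.
Lemma actC_d0 g x : d0C (actEC g x) = actVC g (d0C x).
Proof. by rewrite (repEK x) actEC_mk !d0C_mk actVC_mk. Qed.
Lemma actC_bar g x : barC (actEC g x) = actEC g (barC x).
Proof. by rewrite (repEK x) actEC_mk !barC_mk actEC_mk mulgA. Qed.
Lemma actC_no_inversion g x : actEC g x <> barC x.
Proof. by rewrite (repEK x) actEC_mk barC_mk => /mkE_inj[/esym/bar_neq]. Qed.

Definition coset_Gtree : Gtree G := @GTree G coset_graph coset_tree actVC actEC
  actVC1 actVCM actEC1 actECM actC_d0 actC_bar actC_no_inversion.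

Definition coset_piV (x : vertex coset_Gtree) : vertex A := (sval (x : vcoset)).1.
Definition coset_piE (x : edge coset_Gtree) : edge A := (sval (x : ecoset)).1.

Lemma coset_stabV v g :
  stabV (mkV v g : vertex coset_Gtree) = cyclic_set (g * a v * g^-1).
Proof.
rewrite -conj_by_cyclic; apply/seteqP; split=> [h|_ [x vx <-]]; rewrite /stabV /=.
  rewrite actVC_mk => /esym/mkV_inj[_ H].
  by exists (g^-1 * (h * g)) => //; rewrite !mulgA mulgV mul1g mulgK.
by rewrite actVC_mk mulgVK; apply/esym/mkV_eq; rewrite mulKg.
Qed.

Lemma coset_stabE e g :
  stabE (mkE e g : edge coset_Gtree) = cyclic_set ((g * a (d0 e) * g^-1) ^z gi e).
Proof.
rewrite -expgzJ -conj_by_cyclic; apply/seteqP; split=> [h|_ [x vx <-]]; rewrite /stabE /=.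
  rewrite actEC_mk => /esym/mkE_inj[_ H].
  by exists (g^-1 * (h * g)) => //; rewrite !mulgA mulgV mul1g mulgK.
by rewrite actEC_mk mulgVK; apply/esym/mkE_eq; rewrite mulKg.
Qed.

Lemma vertex_gen_infinite_order v : infinite_order (a v).
Proof.
apply: infinite_orderP => k vk.
by have [] := @fs_reduced _ _ _ _ _ fsS v [::] k erefl I vk.
Qed.

Lemma cyclic_setX (x y : G) k :
  cyclic_set x = cyclic_set y -> cyclic_set (x ^z k) `<=` cyclic_set (y ^z k).
Proof.
move=> xy; apply: cyclic_set_sub; first exact: cyclic_subgroup.
have [n _ <-] : cyclic_set y x by rewrite -xy; exact: cyclic_set_gen.
by exists n; rewrite // expgzC.
Qed.

Lemma coset_bass_serre : bass_serre coset_piV coset_piE.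
Proof.
split=> //.
- move=> x y; rewrite (repVK (x : vcoset)) (repVK (y : vcoset)) /coset_piV /= => ->.
  by exists (repV y * (repV x)^-1); rewrite /= actVC_mk mulgVK.
- by move=> v; exists (mkV v 1).
- by move=> e; exists (mkE e 1).
- move=> x; rewrite (repVK (x : vcoset)) coset_stabV.
  exists (repV x * a (sval (x : vcoset)).1 * (repV x)^-1) => //.
  exact/infinite_orderJ/vertex_gen_infinite_order.
- move=> x z; rewrite (repEK (x : ecoset)) [d0 _]d0C_mk coset_stabV coset_stabE.
  move=> zE; rewrite /coset_piE /=.
  by apply/seteqP; split; apply: cyclic_setX.
Qed.

End CosetTree.

Lemma bass_serre_tree (A : Zgraph) (G : groupType) : has_fundamental_group A G ->
  exists (T : Gtree G) (piV : vertex T -> vertex A) (piE : edge T -> edge A),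
    bass_serre piV piE.
Proof.
move=> /has_fundamental_system[S [a [t [treeS fsS]]]].
by exists (coset_Gtree treeS fsS), (@coset_piV _ _ _ _ _ treeS fsS),
  (@coset_piE _ _ _ _ _ treeS fsS); apply: coset_bass_serre.
Qed.

(** * Finiteness from bounds on vertices and indices *)

(** This bounds the number of edges. An edge of the maximal tree is determined
    by its ends. Another edge [e] is determined by the homomorphism to a group
    of order three that sends its stable letter to 1, that of [bar e] to -1 and
    the others to 0, hence by the values of this homomorphism on the
    generators; order three tells [e] from [bar e]. *)
Lemma edge_injection (A : Zgraph) (G : groupType) (a : vertex A -> G) (t : edge A -> G)
    (S : set (edge A)) (s : seq G) (N : nat) (fV : vertex A -> 'I_N) :
  spanning_tree S -> fundamental_system a t S ->
  (forall H, is_subgroup H -> [set` s] `<=` H -> H = setT) ->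
  injective fV ->
  exists fE : edge A -> ('I_N * 'I_N) + {ffun 'I_(size s) -> 'I_3}, injective fE.
Proof.
move=> treeS fsS gen_s fV_inj; have [Sbar _ Sloop] := treeS.
have hom e : ~ S e -> exists c : edge A -> 'I_3, exists chi : G -> 'I_3,
    [/\ c e = 1%R, forall x, c x = 1%R -> x = e,
        forall g h, chi (g * h)%g = (chi g + chi h)%R & forall x, chi (t x) = c x].
  move=> Se; pose c (x : edge A) : 'I_3 :=
    (if `[< x = e >] then 1 else if `[< x = bar e >] then -1 else 0)%R.
  have ee : `[< e = e >] by exact/asboolP.
  have eb : `[< e = bar e >] = false by apply/asboolPn => E; apply: (bar_neq (esym E)).
  have be : `[< bar e = e >] = false by apply/asboolPn => /bar_neq.
  have bb : `[< bar e = bar e >] by exact/asboolP.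
  have cbar x : c (bar x) = (- c x)%R.
    rewrite /c; have [->|xe] := pselect (x = e); first by rewrite be bb ee.
    have [->|xb] := pselect (x = bar e); first by rewrite barK ee be bb opprK.
    rewrite (asboolF xe) (asboolF xb) !asboolF ?oppr0 // => E.
      by apply: xe; apply: bar_inj.
    by apply: xb; rewrite -E barK.
  have cS x : S x -> c x = 0%R.
    move=> Sx; rewrite /c; case: asboolP => [xe|_]; first by rewrite xe in Sx.
    by case: asboolP => // xe; case: Se; rewrite -[e]barK -xe; apply: Sbar.
  have [chi [chiM chic]] := fs_hom fsS cbar cS.
  exists c, chi; split=> //; first by rewrite /c ee.
  by move=> x; rewrite /c; case: asboolP => // _; case: asboolP.
have /choice[F HF] (e : edge A) : exists y : ('I_N * 'I_N) + {ffun 'I_(size s) -> 'I_3},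
    (S e /\ y = inl (fV (d0 e), fV (d1 e))) \/
    (exists c : edge A -> 'I_3, exists chi : G -> 'I_3,
      [/\ c e = 1%R, forall x, c x = 1%R -> x = e,
        forall g h, chi (g * h)%g = (chi g + chi h)%R, forall x, chi (t x) = c x &
        y = inr [ffun i : 'I_(size s) => chi (nth 1%g s i)]]).
  have [Se|/hom[c [chi [c1 c2 chiM chic]]]] := pselect (S e).
    by exists (inl (fV (d0 e), fV (d1 e))); left.
  by exists (inr [ffun i : 'I_(size s) => chi (nth 1%g s i)]); right; exists c, chi.
exists F => e e' FE.
have [[Se ye]|[c [chi [c1 _ chiM chic ye]]]] := HF e;
  have [[Se' ye']|[c' [chi' [_ c2' chiM' chic' ye']]]] := HF e';
  move: FE; rewrite ye ye' => // -[].
  move=> /fV_inj d0E /fV_inj d1E.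
  apply: contrapT => ee'.
  suff : [:: e; bar e'] = [::] by [].
  apply: (Sloop (d0 e)).
    split=> //; split; [exact: Sbar | by rewrite d0_bar | by rewrite /= d1_bar].
  apply: reduced_path_cons => [p' [/bar_inj E _]|]; first by apply: ee'.
  by apply: reduced_path_cons => //; apply: reduced_path_nil.
move=> /ffunP FE; apply: c2'; rewrite -chic' -c1 -chic.
suff HT : [set g | chi' g = chi g] = setT.
  by have : [set g | chi' g = chi g] (t e) by rewrite HT.
have chi1 (psi : G -> 'I_3) :
    (forall g h, psi (g * h)%g = (psi g + psi h)%R) -> psi 1%g = 0%R.
  by move=> psiM; apply: (addrI (psi 1%g)); rewrite -psiM mulg1 addr0.
apply: gen_s => [|g gs].
  apply/is_subgroupP; split=> [|x y /= xE yE|x /= xE]; first by rewrite /= !chi1.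
    by rewrite chiM' chiM xE yE.
  apply: (addrI (chi' x)); rewrite -chiM' xE -chiM mulgV !chi1 //.
have si : (index g s < size s)%N by rewrite index_mem.
by have := FE (Ordinal si); rewrite !ffunE /= nth_index.
Qed.

Section Coding.
Variables (N K : nat) (E : finType).

Definition index_code (i : int) : 'I_(K + K).+1 := inord `|(i + Posz K)%R|%N.

Lemma index_code_inj i j : (`|i| <= K)%N -> (`|j| <= K)%N ->
  index_code i = index_code j -> i = j.
Proof.
by move=> iK jK /(congr1 val) /=; rewrite !inordK; lia.
Qed.

Definition code : finType :=
  ({ffun 'I_N -> bool} * {ffun E * 'I_N -> bool} * {ffun E * E -> bool} *
   {ffun E * 'I_(K + K).+1 -> bool})%type.

(** The code is the transport of the structure of [A] along injections of its
    vertices and edges in fixed finite types. *)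
Definition coded (A : Zgraph) (c : code) : Prop :=
  exists (fV : vertex A -> 'I_N) (fE : edge A -> E),
  [/\ injective fV, injective fE, forall e : edge A, (`|gi e| <= K)%N &
   c = ([ffun x => `[< exists v, fV v = x >]],
        [ffun x => `[< exists e, (fE e, fV (d0 e)) = x >]],
        [ffun x => `[< exists e, (fE e, fE (bar e)) = x >]],
        [ffun x => `[< exists e, (fE e, index_code (gi e)) = x >]])].

Lemma coded_iso A B c : coded A c -> coded B c -> Zgraph_iso A B.
Proof.
move=> [fV [fE [fV_inj fE_inj giA ->]]] [gV [gE [gV_inj gE_inj giB]]] [].
move=> /ffunP H1 /ffunP H2 /ffunP H3 /ffunP H4.
have /choice[hV hVE] v : exists w, gV w = fV v.
  by have := H1 (fV v); rewrite !ffunE asboolT; [move/esym/asboolP | exists v].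
have /choice[kV kVE] w : exists v, fV v = gV w.
  by have := H1 (gV w); rewrite !ffunE => /esym; rewrite asboolT; [move/esym/asboolP | exists w].
have /choice[hE hEE] (e : edge A) :
    exists e' : edge B, gE e' = fE e /\ gV (d0 e') = fV (d0 e).
  have := H2 (fE e, fV (d0 e)); rewrite !ffunE asboolT; last by exists e.
  by move=> /esym/asboolP[e' [? ?]]; exists e'.
have /choice[kE kEE] (e : edge B) : exists e' : edge A, fE e' = gE e.
  have := H2 (gE e, gV (d0 e)); rewrite !ffunE => /esym; rewrite asboolT; last by exists e.
  by move=> /esym/asboolP[e' [? ?]]; exists e'.
exists hV, hE, (fun _ => idfun : {additive int -> int}),
  (fun _ => idfun : {additive int -> int}); split=> //.
- split; first by exists kV => v; [apply: fV_inj | apply: gV_inj]; rewrite ?kVE ?hVE ?kVE.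
  by exists kE => e; [apply: fE_inj | apply: gE_inj];
    rewrite ?(hEE _).1 ?kEE ?(hEE _).1.
- move=> e; split; first by apply: gV_inj; rewrite (hEE e).2 hVE.
  apply: (gE_inj); rewrite (hEE (bar e)).1.
  have := H3 (fE e, fE (bar e)); rewrite !ffunE asboolT; last by exists e.
  move=> /esym/asboolP[e' []]; rewrite -{1}(hEE e).1 => /gE_inj -> //.
- by split=> ?; exists idfun.
- move=> e n /=; congr (_ * _)%R.
  have := H4 (fE e, index_code (gi e)); rewrite !ffunE asboolT; last by exists e.
  move=> /esym/asboolP[e' []]; rewrite -{1}(hEE e).1 => /gE_inj -> /index_code_inj -> //.
Qed.

Lemma coded_finite : exists (n : nat) (L : 'I_n -> Zgraph),
  forall A : Zgraph, (exists fV : vertex A -> 'I_N, injective fV) ->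
    (exists fE : edge A -> E, injective fE) ->
    (forall e : edge A, (`|gi e| <= K)%N) -> exists k, Zgraph_iso A (L k).
Proof.
pose good := [pred c : code | `[< exists A, coded A c >]].
have /choice[L HL] (k : 'I_#|good|) : exists A, coded A (enum_val k).
  by have := enum_valP k; rewrite inE => /asboolP.
exists #|good|, L => A [fV fV_inj] [fE fE_inj] giK.
have [c Ac] : exists c, coded A c by eexists; exists fV, fE.
have gc : c \in good by rewrite inE; apply/asboolP; exists A.
exists (enum_rank_in gc c); apply: coded_iso Ac _.
by have := HL (enum_rank_in gc c); rewrite enum_rankK_in.
Qed.

End Coding.


(** * Comparison of two reduced decompositions *)

Lemma In_nth T (x0 x : T) s : List.In x s -> exists2 i, (i < size s)%N & nth x0 s i = x.
Proof.
elim: s => // y s IH [->|/IH[i si <-]]; first by exists 0%N.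
by exists i.+1.
Qed.

Section Comparison.
Variables (G : groupType) (c : G) (s : seq G).
Hypothesis ci : infinite_order c.
Hypothesis cc : commensurated c.
Hypothesis cq : no_integral_modulus c.
Hypothesis gen_s : forall H, is_subgroup H -> [set` s] `<=` H -> H = setT.
Local Open Scope group_scope.

(** When [c] is hyperbolic the tree is the axis of [c], and [A] is one of
    finitely many small graphs, whatever the moduli. *)
Lemma line_bounds (A : Zgraph) (T : Gtree G) (piV : vertex T -> vertex A)
    (piE : edge T -> edge A) :
  bass_serre piV piE -> reduced A -> (forall x : vertex T, actV c x <> x) ->
  (forall e : edge A, `|gi e| <= 2)%N /\ exists f : vertex A -> 'I_2, injective f.
Proof.
move=> bsT redA c_free; apply: (line_quotient bsT redA).
have inhT : inhabited (vertex T).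
  by case: (zg_connected A) => -[v] _; have [x _] := piV_surj bsT v.
have [v [p vp]] := axis_exists inhT c_free.
by apply: line_valence vp => // e u; apply: orbit_separated bsT e u redA.
Qed.

Section Elliptic.
Variables (A : Zgraph) (T : Gtree G).
Variables (piV : vertex T -> vertex A) (piE : edge T -> edge A).
Hypothesis bsT : bass_serre piV piE.
Variable p : vertex T.
Hypothesis cp : actV c p = p.
Implicit Types (x y : vertex T) (e : edge T) (g h z : G).

Lemma elliptic_commens x z : stabV x = cyclic_set z -> commens z c.
Proof.
move=> xz; have [z' pz' _] := bs_stabV bsT p.
apply: commens_trans (stabV_commens (bs_GBS_tree bsT) xz pz') _; apply: commens_sym.
have [k _ zk] : cyclic_set z' c by rewrite -[cyclic_set _]pz'.
rewrite -zk; apply: commensX => k0; rewrite k0 in zk.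
by have := @infinite_order_neq0 _ c 1%R ci; rewrite -{1}zk => /(_ erefl).
Qed.

Lemma elliptic_of_commens z : commens z c -> exists x, actV z x = x.
Proof.
case=> m [n [m0 n0 zc]]; apply: (fixed_vertex_of_power (u := p) m0).
rewrite zc; have : stabV p (c ^z n); last by [].
have [z' pz' _] := bs_stabV bsT p.
by apply: (cyclic_set_sub (x := c)); [rewrite pz'; apply: cyclic_subgroup | | exists n].
Qed.

Hypothesis redA : reduced A.

Lemma elliptic_powers n : stabV p (c ^z n).
Proof.
have [z pz _] := bs_stabV bsT p.
by apply: (cyclic_set_sub (x := c)); [rewrite pz; apply: cyclic_subgroup | | exists n].
Qed.

Lemma elliptic_edge (a : edge A) : exists e g,
  [/\ piE e = a, g \in s & half e p != half e (actV g p)].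
Proof.
have [e ea] := piE_surj bsT a.
have [h [g [gs sep]]] := generator_separated bsT e p redA gen_s.
exists (actE h^-1 e), g; split=> //; first by rewrite (piE_act bsT).
by move: sep; rewrite -(half_act h^-1) actVK -(half_act h^-1 e (actV (h * g) p)) actVM actVK.
Qed.

Lemma elliptic_edge_power (a : edge A) : exists e g, [/\ piE e = a, g \in s &
  forall m n, conj_power c g m n -> stabE e (c ^z n)].
Proof.
have [e [g [ea gs sep]]] := elliptic_edge a; exists e, g; split=> // m n [_ _ gmn].
apply: fix_separating sep; first exact: elliptic_powers.
by rewrite -gmn -!actVM mulgVK actVM [actV (c ^z m) p]elliptic_powers.
Qed.

(** The edges of [A] lie under the finitely many paths from [p] to [g p], for
    the generators [g]. *)
Lemma finite_vertices : exists l : seq (vertex A), forall v, List.In v l.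
Proof.
have /choice[Q QP] (g : G) : exists q, edge_path setT p (actV g p) q.
  by have [q [qP _]] := tree_path (gt_tree T) p (actV g p); exists q.
pose ends (e : edge T) := [:: d0 (piE e); d1 (piE e)].
pose l g := flatten [seq ends e | e <- Q g].
have In_l g e v : List.In e (Q g) -> List.In v (ends e) -> List.In v (l g).
  rewrite /l; elim: (Q g) => // f q IH eq ve.
  rewrite -[flatten _]/(ends f ++ flatten [seq ends e | e <- q]).
  by apply/In_cat; case: eq => [->|eq]; [left | right; apply: IH].
exists (piV p :: flatten [seq l g | g <- s]) => v.
have [_ /(_ v (piV p)) [[|a q] /=]] := zg_connected A; first by left.
case=> _ av _; right.
have [e [g [ea gs sep]]] := elliptic_edge a.
have vl : List.In v (l g).
  have [H|H] := half_separates (QP g) sep; apply: In_l H _; rewrite /= -av -ea; first by left.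
  by right; left; rewrite (piE_bar bsT) d1_bar.
elim: (s) gs => //= g' s' IH; rewrite inE => /predU1P[<-|/IH H]; apply/In_cat; first by left.
by right.
Qed.

End Elliptic.

Section TwoTrees.
Variables (A0 : Zgraph) (T0 : Gtree G).
Variables (piV0 : vertex T0 -> vertex A0) (piE0 : edge T0 -> edge A0).
Hypothesis bsT0 : bass_serre piV0 piE0.
Variable p0 : vertex T0.
Hypothesis cp0 : actV c p0 = p0.

Variables (A : Zgraph) (T : Gtree G).
Variables (piV : vertex T -> vertex A) (piE : edge T -> edge A).
Hypothesis bsT : bass_serre piV piE.
Variable p : vertex T.
Hypothesis cp : actV c p = p.
Hypothesis redA : reduced A.

(** [stabV x] fixes some [u] in [T0], and [stabV u] some [y] in [T]; by
    maximality in [T] the three stabilizers agree. *)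
Lemma same_stabV (x : vertex T) : exists u : vertex T0, stabV x = stabV u.
Proof.
have [z xz _] := bs_stabV bsT x.
have [u zu] := elliptic_of_commens bsT0 cp0 (elliptic_commens bsT cp xz).
have [zu' uz' _] := bs_stabV bsT0 u.
have [y zy] := elliptic_of_commens bsT cp (elliptic_commens bsT0 cp0 uz').
have xu : stabV x `<=` stabV u.
  by rewrite xz; apply: cyclic_set_sub zu; rewrite uz'; apply: cyclic_subgroup.
have uy : stabV u `<=` stabV y.
  have [zz yz _] := bs_stabV bsT y.
  by rewrite uz'; apply: cyclic_set_sub zy; rewrite yz; apply: cyclic_subgroup.
have [xy _] := stabV_maximal bsT redA cq (elliptic_commens bsT cp) (subset_trans xu uy).
by exists u; apply/seteqP; split=> //; rewrite xy.
Qed.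

Lemma vertex_injection : exists f : vertex A -> vertex A0, injective f.
Proof.
have /choice[f Hf] v : exists w, exists x u, [/\ piV x = v, piV0 u = w & stabV x = stabV u].
  have [x xv] := piV_surj bsT v; have [u xu] := same_stabV x.
  by exists (piV0 u), x, u.
exists f => v1 v2 f12.
have [x1 [u1 [x1E u1E xu1]]] := Hf v1; have [x2 [u2 [x2E u2E xu2]]] := Hf v2.
have [|g u2g] := piV_orbit bsT0 (_ : piV0 u1 = piV0 u2); first by rewrite u1E u2E f12.
have sub : stabV (actV g x1) `<=` stabV x2 by rewrite stabV_act xu1 -stabV_act -u2g xu2.
have [_] := stabV_maximal bsT redA cq (elliptic_commens bsT cp) sub.
by rewrite (piV_act bsT) x1E x2E.
Qed.

Variables (u : vertex A0 -> vertex T0) (z : vertex A0 -> G).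
Variables (alpha beta : vertex A0 -> int).
Hypothesis uP : forall w, piV0 (u w) = w.
Hypothesis zP : forall w, stabV (u w) = cyclic_set (z w).
Hypothesis zcP : forall w,
  [/\ alpha w <> 0%R, beta w <> 0%R & z w ^z alpha w = c ^z beta w].
Variables (m n : G -> int).
Hypothesis mnP : forall g, conj_power c g (m g) (n g).

(** An edge group of [A] contains, up to conjugation, one of the powers
    [c ^z n g], and its vertex group is conjugate to one of the [z w]. So the
    index divides an exponent [k] such that [c ^z k] is conjugate to one of
    finitely many powers of [c], and there are finitely many such [k]. *)
Lemma index_conj_power (a : edge A) : exists g w h k,
  [/\ g \in s, conj_power c h k (n g * alpha w)%R & (gi a %| k)%Z].
Proof.
have [e [g [ea gs ge]]] := elliptic_edge_power bsT cp redA a.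
have {}ge := ge _ _ (mnP g); have [_ n0 _] := mnP g.
have [u0 eu] := same_stabV (d0 e).
have [|h hu] := piV_orbit bsT0 (_ : piV0 (u (piV0 u0)) = piV0 u0); first by rewrite uP.
set w := piV0 u0 in hu; have [al0 be0 zc] := zcP w.
have ez : stabV (d0 e) = cyclic_set (h * z w * h^-1).
  by rewrite eu hu stabV_act zP conj_by_cyclic.
move: ge; rewrite (bs_stabE bsT ez) ea => -[k _ ck].
exists g, w, h, (beta w * gi a * k)%R; split=> //; last first.
  by rewrite mulrAC -mulrA; apply: dvdz_mull; apply: dvdz_mull.
have k0 : k <> 0%R.
  move=> k0; rewrite k0 in ck; apply: n0; apply: (infinite_order_neq0 ci).
  by rewrite -ck.
split; [|exact: mulz_neq0|].
  by apply: mulz_neq0 => //; apply: mulz_neq0 => //; apply: gi_neq0.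
rewrite -mulrA expgzM -zc !expgzJ [RHS]expgzM -ck.
by rewrite -!expgzM mulrC mulrA.
Qed.

End TwoTrees.
End Comparison.

Section Bounds.
Variables (G : groupType) (c : G) (s : seq G).
Hypothesis ci : infinite_order c.
Hypothesis cc : commensurated c.
Hypothesis cq : no_integral_modulus c.
Hypothesis gen_s : forall H, is_subgroup H -> [set` s] `<=` H -> H = setT.
Local Open Scope group_scope.

Definition elliptic_decomposition (A : Zgraph) : Prop :=
  exists (T : Gtree G) (piV : vertex T -> vertex A) (piE : edge T -> edge A),
    bass_serre piV piE /\ exists p : vertex T, actV c p = p.

(** All decompositions are compared to a single reference [A0], which is finite
    because [G] is finitely generated. *)
Lemma elliptic_bounds : exists N K, forall A : Zgraph, reduced A ->
  elliptic_decomposition A ->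
  (exists f : vertex A -> 'I_N, injective f) /\ forall a : edge A, (`|gi a| <= K)%N.
Proof.
have [[A0 [redA0 ellA0]]|no] :=
    pselect (exists A0, reduced A0 /\ elliptic_decomposition A0); last by exists 0%N, 0%N => A redA ellA; case: no; exists A.
have [T0 [piV0 [piE0 [bsT0 [p0 cp0]]]]] := ellA0.
have [l lP] := finite_vertices gen_s bsT0 p0 redA0.
have [[w0] _] := zg_connected A0.
have /choice[idx idxP] v : exists i : 'I_(size l), nth w0 l i = v.
  by have [i il iv] := In_nth w0 (lP v); exists (Ordinal il).
have idx_inj : injective idx by move=> v w vw; rewrite -(idxP v) vw idxP.
have /choice[u uP] w : exists x, piV0 x = w by exact: piV_surj bsT0 w.
have /choice[z zP] w : exists z, stabV (u w) = cyclic_set z.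
  by have [z] := bs_stabV bsT0 (u w); exists z.
have /choice[ab abP] w : exists ab : int * int,
    [/\ ab.1 <> 0%R, ab.2 <> 0%R & z w ^z ab.1 = c ^z ab.2].
  by have [m [n zc]] := elliptic_commens ci bsT0 cp0 (zP w); exists (m, n).
have /choice[mn mnP] (g : G) : exists mn : int * int, conj_power c g mn.1 mn.2.
  by have [m [n gmn]] := cc g; exists (m, n).
have fgG : finitely_generated G by exists s.
have /choice[B BP] (n : int) : exists B, forall g M, conj_power c g M n -> (`|M| <= B)%N.
  exact: (conj_power_bounded n fgG ci cc cq).
exists (size l), (\sum_(g <- s) \sum_(i < size l) B ((mn g).2 * (ab (nth w0 l i)).1)%R)%N.
move=> A redA [T [piV [piE [bsT [p cp]]]]]; split.
  have [f f_inj] := vertex_injection ci cq bsT0 cp0 bsT cp redA.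
  by exists (idx \o f); apply: inj_comp.
move=> a; have [g [w [h [k [gs hk /dvdzP[k' kE]]]]]] :=
  index_conj_power ci cq gen_s bsT0 cp0 bsT cp redA uP zP abP mnP a.
have [k0 _ _] := hk.
apply: (@leq_trans `|k|%N).
  rewrite kE abszM leq_pmull // absz_gt0; apply/eqP => k'0.
  by apply: k0; rewrite kE k'0 mul0r.
apply: leq_trans (BP _ _ _ hk) _.
rewrite (big_rem g) //= (bigD1 (idx w)) //= idxP -addnA; exact: leq_addr.
Qed.

End Bounds.

Theorem theorem8p2 (G : groupType) (X : Gtree G) (q : G -> rat) :
  GBS_tree X ->
  finitely_generated G ->
  modular_homomorphism X q ->
  range q `&` [set r : rat | r \is a Num.int] = [set 1%R] ->
  exists (n : nat) (L : 'I_n -> Zgraph),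
    forall A : Zgraph, reduced A -> has_fundamental_group A G ->
      exists k : 'I_n, Zgraph_iso A (L k).
Proof.
move=> gbsX [s gen_s] [V [/is_subgroupP sV [x Vx] qE]] q1.
have [c xc ci] := stabV_gen gbsX x.
have cc : commensurated c := stabV_commensurated gbsX xc.
have cq : no_integral_modulus c.
  by rewrite xc in Vx; apply: no_integral_modulusP ci sV Vx qE q1.
have [N [K NK]] := elliptic_bounds ci cc cq gen_s.
have [n [L HL]] := coded_finite N.+2 K.+2
  (('I_N.+2 * 'I_N.+2) + {ffun 'I_(size s) -> 'I_3})%type.
exists n, L => A redA piA.
have [T [piV [piE bsT]]] := bass_serre_tree piA.
have [[f f_inj] giK] : (exists f : vertex A -> 'I_N.+2, injective f) /\
    forall e : edge A, (`|gi e| <= K.+2)%N.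
  have [[p cp]|c_free] := pselect (exists p : vertex T, actV c p = p).
    have [|[f f_inj] giK] := NK A redA; first by exists T, piV, piE; split=> //; exists p.
    split=> [|e]; last by have := giK e; lia.
    exists (widen_ord (leq_trans (leqnSn N) (leqnSn N.+1)) \o f).
    by apply: inj_comp f_inj => i j /(congr1 val) /= /val_inj.
  have [|giK [f f_inj]] := line_bounds cc bsT redA.
    by move=> p cp; apply: c_free; exists p.
  split=> [|e]; last by have := giK e; lia.
  exists (widen_ord (isT : 2 <= N.+2)%N \o f).
  by apply: inj_comp f_inj => i j /(congr1 val) /= /val_inj.
have [S [a [t [treeS fsS]]]] := has_fundamental_system piA.
apply: HL => //; first by exists f.
exact: edge_injection treeS fsS gen_s f_inj.
Qed.
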